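(* Let $G$ be a group with the BCQO property. If $\overline{\mathrm{d}}(\chi_F(G))>0$, then there are infinitely many primes $p$ such that $G$ has a quotient isomorphic to $\mathrm{D}_{2p}$.
   Context: $\mathbb{N}$ denotes the set of positive integers. A group $G$ has the BCQO property (''bounded cyclic quotient order'') if there exists $n\in\mathbb{N}$ such that every cyclic quotient of $G$ has order at most $n$ (in particular $G$ has no infinite cyclic quotient). For a group $G$, $\chi_F(G)$ denotes the set of orders of finite quotients of $G$. For $X\subseteq\mathbb{N}$, the upper natural density is $\overline{\mathrm{d}}(X)=\limsup_{n\to\infty}\frac{|X\cap\{1,\ldots,n\}|}{n}$. $\mathrm{D}_{2n}$ denotes the dihedral group of order $2n$. $G$ is not assumed to be finitely generated. *)

(* Defs.v *)
From HB Require Import structures.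
From mathcomp Require Import all_boot all_order all_algebra finmap.
From mathcomp Require Import fingroup extremal generic_quotient.
From mathcomp Require Import boolp classical_sets functions cardinality.
From mathcomp Require Import reals ereal sequences.

Set Implicit Arguments.
Unset Strict Implicit.
Unset Printing Implicit Defensive.

Import Algebra.

Local Open Scope classical_set_scope.
Local Open Scope group_scope.

(* Groups are MathComp [groupType]s, possibly infinite.  The choiceType
   structure they carry is no restriction in the classical setting of boolp:
   every type has one. *)

Record normalSubgroup (G : groupType) := NormalSubgroup {
  nsg_set :> G -> Prop;
  nsg1 : nsg_set 1;
  nsgF : forall x y, nsg_set x -> nsg_set y -> nsg_set (x * y^-1);
  nsgJ : forall x y, nsg_set x -> nsg_set (x ^ y) }.

Section QuotientGroup.
Variables (G : groupType) (N : normalSubgroup G).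

Lemma nsgV x : N x -> N x^-1.
Proof. by move=> Nx; rewrite -[x^-1]mul1g; apply: nsgF => //; apply: nsg1. Qed.

Lemma nsgM x y : N x -> N y -> N (x * y).
Proof. by move=> Nx Ny; rewrite -[y]invgK; apply: nsgF => //; apply: nsgV. Qed.

Definition coset_eq : rel G := fun x y => `[< N (x * y^-1) >].

Lemma coset_eq_refl : reflexive coset_eq.
Proof. by move=> x; apply/asboolP; rewrite mulgV; apply: nsg1. Qed.

Lemma coset_eq_sym : symmetric coset_eq.
Proof.
move=> x y; apply/asboolP/asboolP => /nsgV; by rewrite invgF.
Qed.

Lemma coset_eq_trans : transitive coset_eq.
Proof.
move=> y x z /asboolP Nxy /asboolP Nyz; apply/asboolP.
by rewrite -(divgKA y x z^-1); apply: nsgM.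
Qed.

Canonical coset_equiv :=
  EquivRel coset_eq coset_eq_refl coset_eq_sym coset_eq_trans.

Definition quotient_group := {eq_quot coset_equiv}%qT.

HB.instance Definition _ := EqQuotient.on quotient_group.
HB.instance Definition _ := Choice.on quotient_group.

Local Open Scope quotient_scope.

Definition quotient_pi (x : G) : quotient_group := \pi_quotient_group x.

Definition quotient_one : quotient_group := quotient_pi 1.
Definition quotient_inv (a : quotient_group) : quotient_group :=
  quotient_pi (repr a)^-1.
Definition quotient_mul (a b : quotient_group) : quotient_group :=
  quotient_pi (repr a * repr b).

Lemma quotient_piP x y : quotient_pi x = quotient_pi y <-> N (x * y^-1).
Proof.
split=> [/eqP|Nxy]; first by rewrite eqmodE => /asboolP.
by apply/eqP; rewrite eqmodE; apply/asboolP.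
Qed.

Lemma quotient_reprK a : quotient_pi (repr a) = a.
Proof. exact: reprK. Qed.

Lemma quotient_piM x y :
  quotient_mul (quotient_pi x) (quotient_pi y) = quotient_pi (x * y).
Proof.
apply/quotient_piP.
have /quotient_piP Nx := quotient_reprK (quotient_pi x).
have /quotient_piP Ny := quotient_reprK (quotient_pi y).
set u := repr _ in Nx *; set v := repr _ in Ny *.
have -> : u * v * (x * y)^-1 = (v * y^-1) ^ u^-1 * (u * x^-1).
  by rewrite conjgE invgK invgM -!mulgA mulKg.
by apply: nsgM => //; apply: nsgJ.
Qed.

Lemma quotient_piV x : quotient_inv (quotient_pi x) = quotient_pi x^-1.
Proof.
apply/quotient_piP.
have /quotient_piP/nsgV Nx := quotient_reprK (quotient_pi x).
set u := repr _ in Nx *.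
have -> : u^-1 * x^-1^-1 = (u * x^-1)^-1 ^ u.
  by rewrite invgF invgK conjgE mulgVK.
exact: nsgJ.
Qed.

Lemma quotient_mulA : associative quotient_mul.
Proof.
move=> a b c; rewrite -(quotient_reprK a) -(quotient_reprK b).
by rewrite -(quotient_reprK c) !quotient_piM mulgA.
Qed.

Lemma quotient_mul1 : left_id quotient_one quotient_mul.
Proof. by move=> a; rewrite -(quotient_reprK a) quotient_piM mul1g. Qed.

Lemma quotient_mulr1 : right_id quotient_one quotient_mul.
Proof. by move=> a; rewrite -(quotient_reprK a) quotient_piM mulg1. Qed.

Lemma quotient_mulV : left_inverse quotient_one quotient_inv quotient_mul.
Proof.
by move=> a; rewrite -(quotient_reprK a) quotient_piV quotient_piM mulVg.
Qed.

Lemma quotient_mulrV : right_inverse quotient_one quotient_inv quotient_mul.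
Proof.
by move=> a; rewrite -(quotient_reprK a) quotient_piV quotient_piM mulgV.
Qed.

HB.instance Definition _ := isGroup.Build quotient_group
  quotient_mulA quotient_mul1 quotient_mulr1 quotient_mulV quotient_mulrV.

End QuotientGroup.

Definition cyclic_group (H : groupType) : Prop :=
  exists x : H, forall y : H, exists n : nat, y = x ^+ n \/ y = x ^- n.

Definition isomorphic_groups (H K : groupType) : Prop :=
  exists f : UMagmaMorphism.type H K, bijective f.

Definition has_order (H : groupType) (m : nat) : Prop :=
  ([set: H] #= `I_m)%card.

Definition BCQO (G : groupType) : Prop :=
  exists2 n : nat, (0 < n)%N &
    forall N : normalSubgroup G,
      cyclic_group (quotient_group N) ->
      ([set: quotient_group N] #<= `I_n)%card.

Definition finite_quotient_orders (G : groupType) : set nat :=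
  [set m | exists N : normalSubgroup G, has_order (quotient_group N) m].

Definition upper_density (R : realType) (X : set nat) : \bar R :=
  limn_esup (fun n : nat =>
    (#|` fset_set (X `&` [set k | (1 <= k <= n)%N])|%:R / n%:R)%R%:E).

Definition has_quotient_isomorphic_to (G H : groupType) : Prop :=
  exists N : normalSubgroup G, isomorphic_groups (quotient_group N) H.

(* Main.v *)
Require Import Defs.
From HB Require Import structures.
From mathcomp Require Import all_boot all_order all_algebra finmap.
From mathcomp Require Import all_fingroup all_solvable finfield generic_quotient.
From mathcomp Require Import boolp classical_sets functions cardinality.
From mathcomp Require Import reals ereal topology normedtype sequences exp.
From mathcomp Require Import ring lra zify.

(** Let n0 bound the orders of the cyclic quotients of G, and let Q be a quotient
of order n <= x.  If a prime p > n0 divides n exactly once and n has no divisor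
kp+1 with k > 0, then the Sylow p-subgroup P of Q is normal of order p and
Q/C_Q(P) is a cyclic quotient of order d | p-1 with d <= n0.  If moreover p-1 has
no divisor in [3, n0] then d <= 2; by Schur-Zassenhaus P has a complement K, and
Q/C_K(P) has order dp: it is cyclic of order p > n0 for d = 1, which is
impossible, and dihedral for d = 2.

It remains to see that almost every n <= x has such a prime factor p > z, where z
is a small power of x.  Few n are divisible by p^2 or by p(kp+1) for some p > z,
since the sum of x/(p^2 k) is O(x log x / z).  The arithmetic condition on p - 1
holds when p is a nonresidue for the character mod 4 and for the Legendre symbols
of all odd primes q <= n0, and the sum of 1/p over such p in (z, x] is large by
Mertens' argument, which involves only the quadratic characters obtained as
products of these.  By Turan's inequality, few n have no such prime factor. *)

Set Implicit Arguments.
Unset Strict Implicit.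
Unset Printing Implicit Defensive.

Import Order.TTheory GRing.Theory Num.Theory.

Local Open Scope ring_scope.

(** * The von Mangoldt function *)

Lemma sum_multiples (V : nmodType) (d x : nat) (F : nat -> V) : (0 < d)%N ->
  \sum_(1 <= n < x.+1 | (d %| n)%N) F (n %/ d)%N =
  \sum_(1 <= m < (x %/ d).+1) F m.
Proof.
move=> d0; elim: x => [|x IH]; first by rewrite div0n !big_geq.
rewrite big_mkcond big_nat_recr //= -big_mkcond /= IH divnS //.
case: ifP => dx /=; last by rewrite addr0.
by rewrite add1n [RHS]big_nat_recr //= dx.
Qed.

(** The substitution n = d m, by which every Dirichlet convolution below is summed. *)
Lemma sum_divisors_exchange (V : nmodType) (x : nat) (F : nat -> nat -> V) :
  \sum_(1 <= n < x.+1) \sum_(1 <= d < n.+1 | (d %| n)%N) F d (n %/ d)%N =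
  \sum_(1 <= d < x.+1) \sum_(1 <= m < (x %/ d).+1) F d m.
Proof.
transitivity (\sum_(1 <= n < x.+1) \sum_(1 <= d < x.+1 | (d %| n)%N)
    F d (n %/ d)%N).
  apply: eq_big_nat => n /andP[n1 nx].
  rewrite [RHS](big_cat_nat (n := n.+1)) //= [X in _ = _ + X]big_nat_cond.
  rewrite [X in _ = _ + X]big1 ?addr0 // => d /andP[/andP[nd _] dn].
  by have := dvdn_leq n1 dn; rewrite leqNgt nd.
under eq_bigr do rewrite big_mkcond.
rewrite exchange_big /=; apply: eq_big_nat => d /andP[d1 _].
by rewrite -big_mkcond sum_multiples.
Qed.

(** * Elementary estimates for logarithms and harmonic sums *)

Section RealSums.
Variable R : realType.
Implicit Types (n m x d : nat).

Lemma ln_nat_ge0 n : 0 <= ln (n%:R : R).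
Proof.
case: n => [|n]; first by rewrite ln0.
by apply: ln_ge0; rewrite ler1n.
Qed.

Lemma ln_natS_sub_le n : (0 < n)%N -> ln n.+1%:R - ln n%:R <= n%:R^-1 :> R.
Proof.
move=> n0; have n0R : 0 < n%:R :> R by rewrite ltr0n.
rewrite -ln_div ?posrE ?ltr0n // -natr1 mulrDl divff ?gt_eqF // mul1r.
by apply: le_ln1Dx; rewrite (lt_le_trans (ltrN10 _)) // invr_ge0 ltW.
Qed.

Lemma ln_natS_sub_ge n : (0 < n)%N -> n.+1%:R^-1 <= ln n.+1%:R - ln n%:R :> R.
Proof.
move=> n0; have n0R : 0 < n%:R :> R by rewrite ltr0n.
have -> : ln n.+1%:R - ln n%:R = - ln (n%:R / n.+1%:R) :> R.
  by rewrite ln_div ?posrE ?ltr0n // opprB.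
have -> : n%:R / n.+1%:R = 1 + - n.+1%:R^-1 :> R.
  by rewrite -natr1; field; rewrite natr1 pnatr_eq0.
rewrite lerNr; apply: le_ln1Dx; rewrite ltrN2 invf_lt1 ?ltr0n // ltr1n.
by rewrite ltnS.
Qed.

Lemma ln_nat_le m n : (0 < m)%N -> (m <= n)%N -> ln m%:R <= ln n%:R :> R.
Proof.
move=> m0 mn; rewrite ler_ln ?posrE ?ltr0n ?ler_nat //.
exact: leq_trans mn.
Qed.

Lemma ln_nat_sub1 n : (0 < n)%N -> ln n%:R <= n%:R - 1 :> R.
Proof.
move=> n0; have := @le_ln1Dx R (n%:R - 1); rewrite subrKC; apply.
by rewrite ltrBrDr addNr ltr0n.
Qed.

Lemma harmonic_le x : (0 < x)%N ->
  \sum_(1 <= n < x.+1) n%:R^-1 <= 1 + ln x%:R :> R.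
Proof.
elim: x => // -[_ _|x IH _]; first by rewrite big_nat1 ln1 invr1 addr0.
rewrite big_nat_recr //=; apply: le_trans (lerD (IH isT) (@ln_natS_sub_ge x.+1 isT)) _.
by rewrite -addrA subrKC.
Qed.

Lemma sum_ln_sqr_le x :
  \sum_(1 <= n < x.+1) ln n%:R / n%:R ^+ 2 <= 2 :> R.
Proof.
case: x => [|x]; first by rewrite big_geq.
(* An antiderivative of ln t / t^2 is -(1 + ln t) / t; putting 2 in place of 1 leaves the slack with
   which the induction closes. *)
suff : \sum_(1 <= n < x.+2) ln n%:R / n%:R ^+ 2
    <= 2 - (2 + ln x.+1%:R) / x.+1%:R :> R.
  move=> /le_trans; apply; rewrite gerBl divr_ge0 //.
  by rewrite addr_ge0 // ln_nat_ge0.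
elim: x => [|x IH]; first by rewrite big_nat1 ln1 mul0r; lra.
rewrite big_nat_recr //=.
have h1 := @ln_natS_sub_le x.+1 isT.
set l := ln x.+2%:R : R; set l' := ln x.+1%:R : R.
rewrite -/l -/l' in h1 IH.
have l0 : 0 <= l by apply: ln_nat_ge0.
apply: le_trans (lerD IH (lexx _)) _.
set a := x.+1%:R : R in h1 IH *; have -> : x.+2%:R = a + 1 by rewrite natr1.
have a1 : 1 <= a by rewrite ler1n.
have a0 : a != 0 by rewrite gt_eqF //; lra.
have a10 : a + 1 != 0 by rewrite gt_eqF //; lra.
have -> : 2 - (2 + l') / a + l / (a + 1) ^+ 2 = 2 - (2 + l) / (a + 1) +
   ((l - l' - a^-1) / a - ((a + 1) * (a - 1) + l * a) / (a ^+ 2 * (a + 1) ^+ 2)).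
  by clearbody a l l'; field; rewrite a0 a10.
clearbody a l l'; rewrite gerDl subr_le0 (@le_trans _ _ 0) //.
  by rewrite mulr_le0_ge0 ?invr_ge0 //; lra.
have p1 : 0 <= (a + 1) * (a - 1) by apply: mulr_ge0; lra.
have p2 : 0 <= l * a by apply: mulr_ge0; lra.
by apply: divr_ge0; [lra | apply: mulr_ge0; apply: exprn_ge0; lra].
Qed.

End RealSums.

Section Mangoldt.
Variable R : realType.
Implicit Types (n m x d p k : nat).

(** At most one term survives, namely ln p when d = p^k. As a double sum it can be exchanged with
    sums over d. *)
Definition mangoldt d : R :=
  \sum_(1 <= p < d.+1 | prime p) \sum_(1 <= k < d.+1 | (p ^ k)%N == d) ln p%:R.

Lemma mangoldt_ge0 d : 0 <= mangoldt d.
Proof. by do 2!apply: sumr_ge0 => ? _; apply: ln_nat_ge0. Qed.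

(** If p^k = d with k >= 1, then p and k are at most d. So one range serves all d <= x, as
    exchanging the sums requires. *)
Lemma mangoldt_widen x d : (d <= x)%N -> mangoldt d =
  \sum_(1 <= p < x.+1 | prime p) \sum_(1 <= k < x.+1 | (p ^ k)%N == d) ln p%:R.
Proof.
move=> dx; rewrite /mangoldt (big_nat_widen _ _ x.+1) //.
rewrite [RHS](bigID (fun p => p < d.+1)%N) /= [X in _ = _ + X]big_nat_cond.
rewrite [X in _ = _ + X]big1 ?addr0; last first.
  move=> p /andP[/andP[p1 _] /andP[pp pd]].
  rewrite big_nat_cond big1 // => k /andP[/andP[k1 _] /eqP pk].
  move: pd; rewrite ltnS -pk => /negP[].
  by rewrite -[X in (X <= _)%N]expn1 leq_pexp2l.
apply: eq_bigr => p /andP[pp pd].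
rewrite (big_nat_widen _ _ x.+1) // big_nat_cond [RHS]big_nat_cond.
apply: eq_bigl => k; case: (_ <= k < _)%N => //=.
case: eqP => //= pk; rewrite -pk ltnS ltnW //.
by rewrite ltn_expl ?prime_gt1.
Qed.

Lemma ln_prod_nat (I : Type) (r : seq I) (P : pred I) (f : I -> nat) :
  (forall i, P i -> 0 < f i)%N ->
  ln (\prod_(i <- r | P i) f i)%:R = \sum_(i <- r | P i) ln (f i)%:R :> R.
Proof.
move=> f0; pose K a (b : nat) := (0 < b)%N /\ ln b%:R = a :> R.
suff [] : K (\sum_(i <- r | P i) ln (f i)%:R) (\prod_(i <- r | P i) f i)%N by [].
apply: big_rec2; rewrite /K; first by rewrite ln1.
move=> i a b Pi [a0 <-]; rewrite muln_gt0 f0 // natrM lnM //.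
all: by rewrite posrE ltr0n ?f0.
Qed.

(** For each prime p there are [logn p n] exponents k >= 1 with p^k dividing n, so the sum is the
    logarithm of the prime factorization of n. *)
Lemma sum_divisors_mangoldt n : (0 < n)%N ->
  \sum_(1 <= d < n.+1 | (d %| n)%N) mangoldt d = ln n%:R.
Proof.
move=> n0.
transitivity (\sum_(1 <= p < n.+1 | prime p)
  \sum_(1 <= k < n.+1 | (p ^ k %| n)%N) ln p%:R : R).
  have -> : \sum_(1 <= d < n.+1 | (d %| n)%N) mangoldt d =
      \sum_(1 <= d < n.+1 | (d %| n)%N) \sum_(1 <= p < n.+1 | prime p)
        \sum_(1 <= k < n.+1 | (p ^ k)%N == d) ln p%:R.
    rewrite big_nat_cond [RHS]big_nat_cond.
    by apply: eq_bigr => d /andP[/andP[_ dn] _]; apply: mangoldt_widen.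
  rewrite exchange_big /=; apply: eq_bigr => p pp.
  under eq_bigr do rewrite big_mkcond.
  rewrite exchange_big [RHS]big_mkcond /=.
  apply: eq_big_nat => k /andP[k1 _].
  under eq_bigr do rewrite eq_sym.
  rewrite -big_mkcondr /=  (big_nat1_cond_eq _ (fun=> ln p%:R) (dvdn^~ n)) /=.
  have -> // : (1 <= p ^ k < n.+1)%N && (p ^ k %| n)%N = (p ^ k %| n)%N.
  apply/andb_idl => pkn; rewrite expn_gt0 prime_gt0 //=.
  by rewrite ltnS dvdn_leq.
rewrite -[in RHS](partnT n0) /partn ln_prod_nat; last first.
  by move=> p _; apply: pfactor_gt0.
rewrite [RHS](@big_cat_nat _ _ _ 1) //= big_nat1.
rewrite [logn 0 n]lognE expn0 ln1 add0r.
rewrite big_mkcond; apply: eq_big_nat => p /andP[p1 _].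
case: ifP => pp; last by rewrite lognE pp expn0 ln1.
under eq_bigl do rewrite pfactor_dvdn // -ltnS.
rewrite -(big_nat_widen 1 (logn p n).+1 n.+1 xpredT) ?ltnS; last first.
  by rewrite ltnW // ltn_logl.
by rewrite sumr_const_nat subn1 natrX lnXn // ltr0n.
Qed.

Lemma mangoldt1 : mangoldt 1 = 0.
Proof.
by have := @sum_divisors_mangoldt 1 isT; rewrite big_mkcond big_nat1 /= ln1.
Qed.

Lemma mangoldt_prime p : prime p -> mangoldt p = ln p%:R.
Proof.
move=> pp; rewrite -sum_divisors_mangoldt ?prime_gt0 //.
rewrite (bigID (fun d => d == p)) /=.
rewrite (big_nat1_cond_eq _ mangoldt (dvdn^~ p)) dvdnn prime_gt0 //= leqnn /=.
rewrite big_nat_cond big1 ?addr0 // => d /andP[_] /andP[dp /negPf nd].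
by case/primeP: pp => _ /(_ d dp); rewrite nd orbF => /eqP->; rewrite mangoldt1.
Qed.

(** The full series is 1 / (p (p - 1)), at most 2 / p^2 since p >= 2. The induction subtracts the
    same bound for the terms still missing. *)
Lemma geometric_tail_le p x : (1 < p)%N ->
  \sum_(2 <= k < x.+1) (p ^ k)%:R^-1 <= 2 / p%:R ^+ 2 :> R.
Proof.
move=> p1; case: x => [|x]; first by rewrite big_geq // divr_ge0 ?exprn_ge0.
have p2 : 2 <= p%:R :> R by rewrite ler_nat.
suff : \sum_(2 <= k < x.+2) (p ^ k)%:R^-1 <=
    2 / p%:R ^+ 2 - 2 / p%:R ^+ x.+2 :> R.
  by move=> /le_trans; apply; rewrite gerBl divr_ge0 // exprn_ge0 // ler0n.
elim: x => [|x IH]; first by rewrite big_geq ?subrr.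
rewrite big_nat_recr //=; apply: le_trans (lerD IH (lexx _)) _.
rewrite natrX [p%:R ^+ x.+3]exprS.
set a := _ / _; set b := p%:R : R; set c := b ^+ x.+2.
have c0 : 0 < c by rewrite exprn_gt0 //; apply: lt_le_trans p2.
have b0 : 0 < b by apply: lt_le_trans p2.
rewrite -subr_ge0.
have -> : a - 2 / (b * c) - (a - 2 / c + c^-1) = (b - 2) / (b * c).
  by clearbody a b c; field; rewrite !gt_eqF.
by rewrite divr_ge0 ?subr_ge0 // mulr_ge0 // ltW.
Qed.

(** Only the powers p^k with k >= 2 contribute, at most 2 ln p / p^2 for each p; [sum_ln_sqr_le]
    then gives 4. *)
Lemma sum_mangoldt_nonprime_le x :
  \sum_(1 <= d < x.+1 | ~~ prime d) mangoldt d / d%:R <= 4.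
Proof.
have -> : \sum_(1 <= d < x.+1 | ~~ prime d) mangoldt d / d%:R =
  \sum_(1 <= d < x.+1 | ~~ prime d) \sum_(1 <= p < x.+1 | prime p)
    \sum_(1 <= k < x.+1 | (p ^ k)%N == d) ln p%:R / d%:R.
  rewrite big_nat_cond [RHS]big_nat_cond.
  apply: eq_bigr => d /andP[/andP[_ dx] _].
  rewrite (mangoldt_widen (x := x)) // mulr_suml; apply: eq_bigr => p _.
  by rewrite mulr_suml.
rewrite exchange_big /=.
apply: (@le_trans _ _ (\sum_(1 <= p < x.+1) 2 * (ln p%:R / p%:R ^+ 2))); last first.
  rewrite -mulr_sumr; have := sum_ln_sqr_le R x.
  set S := \sum_(_ <= _ < _) _; lra.
rewrite big_mkcond; apply: ler_sum => p _; case: ifP => pp; last first.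
  by rewrite mulr_ge0 // divr_ge0 ?ln_nat_ge0 // exprn_ge0.
apply: (@le_trans _ _ (ln p%:R * \sum_(2 <= k < x.+1) (p ^ k)%:R^-1)); last first.
  rewrite mulrCA ler_wpM2l ?ln_nat_ge0 //.
  exact/geometric_tail_le/prime_gt1.
under eq_bigr do rewrite big_mkcond.
rewrite exchange_big /=.
case: x => [|x]; first by rewrite !big_geq // mulr0.
rewrite big_ltn // big1 ?add0r; last first.
  move=> d nd; rewrite expn1; case: eqP => // pd.
  by rewrite -pd pp in nd.
rewrite mulr_sumr; apply: ler_sum => k _.
rewrite -big_mkcondr /=; under eq_bigl do rewrite eq_sym.
rewrite (big_nat1_cond_eq _ (fun d => ln p%:R / d%:R : R) (fun d => ~~ prime d)).
by case: ifP => // _; rewrite divr_ge0 ?ln_nat_ge0.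
Qed.

Lemma ln_fact_mangoldt x :
  ln (x`!)%:R = \sum_(1 <= d < x.+1) mangoldt d * (x %/ d)%:R.
Proof.
rewrite fact_prod big_nat_cond ln_prod_nat; last by move=> i /andP[/andP[]].
rewrite -big_nat_cond -(eq_big_nat _ _ (F1 := fun n =>
   \sum_(1 <= d < n.+1 | (d %| n)%N) mangoldt d)); last first.
  by move=> n /andP[n1 _]; apply: sum_divisors_mangoldt.
rewrite (sum_divisors_exchange x (fun d _ => mangoldt d)).
by apply: eq_bigr => d _; rewrite sumr_const_nat subn1 /= mulr_natr.
Qed.

(** The central binomial coefficient bound binom(2m, m) <= 4^m, freed of division. *)
Lemma fact_double_le m : ((2 * m)`! <= 4 ^ m * m`! ^ 2)%N.
Proof.
elim: m => // m IH; rewrite mulnS !factS expnS.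
move: IH; set a := (2 * m)`!; set b := m`!; set c := (4 ^ m)%N => IH.
apply: (@leq_trans ((2 * m).+2 * ((2 * m).+1 * (c * b ^ 2)))%N).
  by rewrite !leq_mul2l IH !orbT.
have -> : (4 * c * (m.+1 * b) ^ 2)%N = (4 * m.+1 ^ 2 * (c * b ^2))%N by ring.
by rewrite mulnA leq_mul2r; apply/orP; right; lia.
Qed.

(** In ln((2m)!) - 2 ln(m!) the coefficient of [mangoldt R d] is floor(2m/d) - 2 floor(m/d), which
    is never negative and is at least 1 for m < d <= 2m. *)
Lemma sum_mangoldt_double m :
  \sum_(m.+1 <= d < (2 * m).+1) mangoldt d <= 2 * ln 2 * m%:R.
Proof.
have f0 k : 0 < (k`!)%:R :> R by rewrite ltr0n fact_gt0.
have h : ln ((2 * m)`!)%:R <= 2 * ln 2 * m%:R + 2 * ln (m`!)%:R :> R.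
  have -> : 2 * ln 2 * m%:R + 2 * ln (m`!)%:R = ln (4 ^ m * m`! ^ 2)%:R :> R.
    rewrite natrM !natrX lnM ?posrE ?exprn_gt0 // lnXn // lnXn //.
    rewrite (_ : 4 = 2 ^+ 2); last by ring.
    rewrite lnXn //.
    by rewrite -mulrnA -[_ *+ (2 * m)]mulr_natl -[_ *+ 2]mulr_natl natrM; ring.
  by rewrite ler_ln ?posrE ?ler_nat ?fact_double_le // ltr0n muln_gt0 !expn_gt0
    fact_gt0.
apply: le_trans (_ : ln ((2 * m)`!)%:R - 2 * ln (m`!)%:R <= _); last first.
  by rewrite lerBlDr.
have -> : ln (m`!)%:R = \sum_(1 <= d < (2 * m).+1) mangoldt d * (m %/ d)%:R.
  rewrite ln_fact_mangoldt [RHS](@big_cat_nat _ _ _ m.+1) //=; last by lia.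
  rewrite [X in _ = _ + X]big_nat_cond [X in _ = _ + X]big1 ?addr0 //.
  by move=> d /andP[/andP[md _] _]; rewrite divn_small ?mulr0.
rewrite ln_fact_mangoldt mulr_sumr -sumrB.
rewrite [leRHS](@big_cat_nat _ _ _ m.+1) //=; last by lia.
have E d : (mangoldt d * (2 * m %/ d)%:R - 2 * (mangoldt d * (m %/ d)%:R)) =
   mangoldt d * ((2 * m %/ d)%:R - (2 * (m %/ d))%:R).
  by rewrite natrM; ring.
rewrite -[leLHS]add0r lerD //.
  apply: sumr_ge0 => d _; rewrite E mulr_ge0 ?mangoldt_ge0 // subr_ge0 ler_nat.
  case: d => [|d]; first by rewrite !divn0.
  by rewrite leq_divRL // -mulnA leq_mul2l leq_trunc_div orbT.
rewrite big_nat_cond [leRHS]big_nat_cond; apply: ler_sum => d /andP[/andP[md dm] _].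
rewrite E ler_peMr ?mangoldt_ge0 // (@divn_small m d) // muln0 subr0 ler1n.
by rewrite divn_gt0 //; apply: leq_ltn_trans md.
Qed.

Definition chebyshev_psi x : R := \sum_(1 <= d < x.+1) mangoldt d.

Lemma chebyshev_psi_le x : chebyshev_psi x <= 4 * ln 2 * x%:R.
Proof.
have l2 : 0 <= ln 2 :> R by apply: ln_nat_ge0.
elim/ltn_ind: x => x IH; case: (leqP x 1) => [|x1].
  case: x {IH} => [|[|//]] _; rewrite /chebyshev_psi; first by rewrite big_geq // mulr0.
  by rewrite big_nat1 mangoldt1 mulr1 mulr_ge0.
(* With m = ceil(x/2) the interval (m, 2m] covers the rest of [1, x], and the induction closes
   because 3m <= 2x. *)
pose m := uphalf x.
have mx : (x <= 2 * m <= x.+1)%N by rewrite /m; lia.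
have mx' : (m < x)%N by lia.
apply: (@le_trans _ _ (chebyshev_psi m + 2 * ln 2 * m%:R)).
  apply: le_trans (lerD (lexx _) (sum_mangoldt_double m)).
  rewrite /chebyshev_psi -big_cat_nat //=; last by lia.
  rewrite [leRHS](@big_cat_nat _ _ _ x.+1) //=; last by lia.
  by rewrite lerDl sumr_ge0 // => d _; apply: mangoldt_ge0.
case: (leqP x 2) => [x2|x2].
  have -> : m = 1%N by rewrite /m; lia.
  rewrite /chebyshev_psi big_nat1 mangoldt1 add0r mulr1.
  have -> : x = 2%N by lia.
  lra.
apply: le_trans (lerD (IH _ mx') (lexx _)) _.
have : (3 * m)%:R <= (2 * x)%:R :> R by rewrite ler_nat; lia.
rewrite !natrM; nra.
Qed.

(** Mertens' lower bound: x ln x - x <= ln(x!), and replacing floor(x/d) by x/d in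
    [ln_fact_mangoldt] only increases the sum. *)
Lemma sum_mangoldt_div_ge x : (0 < x)%N ->
  ln x%:R - 1 <= \sum_(1 <= d < x.+1) mangoldt d / d%:R.
Proof.
move=> x0; have x0R : 0 < x%:R :> R by rewrite ltr0n.
rewrite -(ler_pM2r x0R).
apply: (@le_trans _ _ (ln (x`!)%:R)).
  elim: x x0 {x0R} => // -[_ _|x IH _]; first by rewrite /= ln1; lra.
  rewrite factS natrM lnM ?posrE ?ltr0n ?fact_gt0 //.
  apply: le_trans (lerD (lexx _) (IH isT)).
  have := @ln_natS_sub_le R x.+1 isT.
  set l := ln _; set l' := ln _; set a := x.+1%:R : R.
  have a0 : 0 < a by rewrite ltr0n.
  have -> : x.+2%:R = a + 1 by rewrite natr1.
  clearbody l l' a => h.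
  have : a * (l - l') <= 1 by rewrite -(ler_pM2l a0) divff ?gt_eqF // in h.
  nra.
rewrite ln_fact_mangoldt mulr_suml big_nat_cond [leRHS]big_nat_cond.
apply: ler_sum => d /andP[/andP[d1 _] _].
rewrite -mulrA ler_wpM2l ?mangoldt_ge0 // mulrC ler_pdivlMr ?ltr0n //.
by rewrite -natrM ler_nat leq_trunc_div.
Qed.

(** Dropping the floors in ln(x!) <= x ln x costs at most psi(x), which Chebyshev bounds by O(x). *)
Lemma sum_mangoldt_div_le x : (0 < x)%N ->
  \sum_(1 <= d < x.+1) mangoldt d / d%:R <= ln x%:R + 4 * ln 2.
Proof.
move=> x0; have x0R : 0 < x%:R :> R by rewrite ltr0n.
rewrite -(ler_pM2r x0R).
apply: (@le_trans _ _ (ln (x`!)%:R + chebyshev_psi x)).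
  rewrite ln_fact_mangoldt mulr_suml -big_split /= big_nat_cond [leRHS]big_nat_cond.
  apply: ler_sum => d /andP[/andP[d1 _] _].
  rewrite -mulrA -{3}[mangoldt d]mulr1 -mulrDr ler_wpM2l ?mangoldt_ge0 //.
  rewrite mulrC ler_pdivrMr ?ltr0n // natr1 -natrM ler_nat.
  by rewrite ltnW // ltn_ceil.
rewrite mulrDl lerD ?chebyshev_psi_le //.
rewrite fact_prod big_nat_cond ln_prod_nat; last by move=> i /andP[/andP[]].
rewrite -big_nat_cond.
apply: (@le_trans _ _ (\sum_(1 <= i < x.+1) ln x%:R)).
  rewrite big_nat_cond [leRHS]big_nat_cond.
  by apply: ler_sum => d /andP[/andP[d1 dx] _]; apply: ln_nat_le.
by rewrite sumr_const_nat subn1 mulr_natr.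
Qed.

End Mangoldt.

(** * Real characters *)

(** Summation by parts: as g is nonnegative and decreasing, the boundary term B g(b) and the
    telescoping variation B (g(a) - g(b)) add up to B g(a). *)
Lemma abel_bound (R : realFieldType) (f g : nat -> R) (B : R) (a b : nat) :
  (forall c, (a <= c)%N -> `|\sum_(a <= n < c) f n| <= B) ->
  (forall n, (a <= n)%N -> 0 <= g n) ->
  (forall n, (a <= n)%N -> g n.+1 <= g n) ->
  `|\sum_(a <= n < b) f n * g n| <= B * g a.
Proof.
move=> fB g0 gd.
have B0 : 0 <= B by apply: le_trans (normr_ge0 _) (fB a (leqnn _)).
case: (leqP a b) => [ab|/ltnW ba]; last by rewrite big_geq // normr0 mulr_ge0 ?g0.
pose F c := \sum_(a <= n < c) f n.
have -> : \sum_(a <= n < b) f n * g n =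
    F b * g b + \sum_(a <= n < b) F n.+1 * (g n - g n.+1).
  elim: b ab => [|b IH] ab.
    by rewrite /F !big_geq // mul0r addr0.
  case: (leqP a b) => [ab'|ba]; last by rewrite /F !big_geq // mul0r addr0.
  rewrite big_nat_recr // IH //= [X in _ = _ + X]big_nat_recr //=.
  by rewrite /F big_nat_recr //=; ring.
have -> : B * g a = B * g b + \sum_(a <= n < b) B * (g n - g n.+1).
  rewrite -mulr_sumr -mulrDr; congr (_ * _).
  under eq_bigr do rewrite -opprB.
  by rewrite sumrN telescope_sumr // opprB subrKC.
apply: le_trans (ler_normD _ _) _; rewrite lerD //.
  by rewrite normrM (ger0_norm (g0 _ ab)) ler_wpM2r ?g0 // fB.
apply: le_trans (ler_norm_sum _ _ _) _.
rewrite big_nat_cond [leRHS]big_nat_cond; apply: ler_sum => n /andP[/andP[an _] _].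
rewrite normrM [X in _ * X]ger0_norm ?subr_ge0 ?gd // ler_wpM2r ?subr_ge0 ?gd //.
by rewrite fB // ltnW.
Qed.

(** A real Dirichlet character whose period M need not be the conductor, so that a product of
    characters may take the product of the periods. *)
Record periodic_character (R : realType) (M : nat) (chi : nat -> R) : Prop :=
  PeriodicCharacter {
    rchi_mod_gt0 : (0 < M)%N;
    rchi1 : chi 1%N = 1;
    rchiM : forall m n, chi (m * n)%N = chi m * chi n;
    rchiP : forall n, chi (n + M)%N = chi n;
    rchi_val : forall n, [\/ chi n = 0, chi n = 1 | chi n = -1] }.

Record real_character (R : realType) (M : nat) (chi : nat -> R) : Prop :=
  RealCharacter {
    rchi_periodic :> periodic_character M chi;
    rchi_nontrivial : exists2 a, coprime M a & chi a = -1 }.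

Lemma rchi_modn (R : realType) (M : nat) (chi : nat -> R) n :
  periodic_character M chi -> chi (n %% M)%N = chi n.
Proof.
move=> chiC; rewrite [in RHS](divn_eq n M).
elim: (n %/ M)%N => [|q IH]; first by rewrite add0n.
by rewrite mulSn -addnA addnC (rchiP chiC).
Qed.

Section Character.
Variables (R : realType) (M : nat) (chi : nat -> R).
Hypothesis chiC : real_character M chi.
Let M0 := rchi_mod_gt0 chiC.

Lemma rchi_norm n : `|chi n| <= 1.
Proof. by case: (rchi_val chiC n) => ->; rewrite ?normr0 ?normrN ?normr1. Qed.

(** Multiplication by a unit [a] with chi a = -1 permutes the residues mod M and changes the sign of
    every value. *)
Lemma rchi_sum_period : \sum_(0 <= n < M) chi n = 0.
Proof.
have [a aM chia] := rchi_nontrivial chiC.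
rewrite big_mkord.
pose f (i : 'I_M) := Ordinal (ltn_pmod (a * i) M0).
have finj : injective f.
  move=> i j /(congr1 val) /= /eqP E; apply/val_inj => /=.
  wlog ij : i j E / (i <= j)%N.
    move=> H; case: (leqP i j) => [|/ltnW] ij; first exact: H.
    by apply/esym/H => //; rewrite eq_sym.
  move: E; rewrite eq_sym eqn_mod_dvd ?leq_mul2l ?ij ?orbT // -mulnBr Gauss_dvdr //.
  by move=> /dvdn_leq; have := ltn_ord j; lia.
have : \sum_(i < M) chi i = - \sum_(i < M) chi i.
  rewrite {1}(reindex_inj finj) -sumrN; apply: eq_bigr => i _ /=.
  by rewrite (rchi_modn _ chiC) (rchiM chiC) chia mulN1r.
lra.
Qed.

Lemma rchi_sum_shift a : \sum_(a <= n < a + M) chi n = 0.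
Proof.
elim: a => [|a IH]; first exact: rchi_sum_period.
move: IH; rewrite big_ltn; last by lia.
rewrite addSn big_nat_recr //=; last by lia.
by rewrite (rchiP chiC) addrC.
Qed.

Lemma rchi_sum_interval a b : `|\sum_(a <= n < b) chi n| <= M%:R.
Proof.
have [k] := ubnP (b - a)%N; elim: k a => // k IH a ka.
case: (ltnP (b - a) M) => [baM|Mba].
  apply: le_trans (ler_norm_sum _ _ _) _.
  apply: (@le_trans _ _ (\sum_(a <= i < b) 1)).
    exact/ler_sum/(fun i _ => rchi_norm i).
  by rewrite sumr_const_nat ler_nat ltnW.
rewrite (@big_cat_nat _ _ _ (a + M)%N) //=; [|lia..].
by rewrite rchi_sum_shift add0r IH //; lia.
Qed.

(** Partial sums of L(1, chi). No limit is formed: nonvanishing will mean a positive lower bound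
    valid for all large x. *)
Definition rchi_L x : R := \sum_(1 <= n < x.+1) chi n / n%:R.

Lemma rchi_L_sub m x : (m <= x)%N -> `|rchi_L x - rchi_L m| <= M%:R / m.+1%:R.
Proof.
move=> mx; rewrite /rchi_L (@big_cat_nat _ _ _ m.+1) //= addrAC subrr add0r.
apply: abel_bound => [c _|n _|n mn]; first exact: rchi_sum_interval.
  by rewrite invr_ge0.
by rewrite lef_pV2 ?posrE ?ler_nat ?ltr0n //; lia.
Qed.

Lemma rchi_ln_bounded x :
  `|\sum_(1 <= n < x.+1) chi n * (ln n%:R / n%:R)| <= M%:R + 3 :> R.
Proof.
have t1 n : `|chi n * (ln n%:R / n%:R)| <= 1.
  rewrite normrM [X in _ * X]ger0_norm ?divr_ge0 ?ln_nat_ge0 //.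
  apply: le_trans (_ : 1 * (ln n%:R / n%:R) <= _).
    by rewrite ler_wpM2r ?rchi_norm // divr_ge0 ?ln_nat_ge0.
  rewrite mul1r; case: n => [|n]; first by rewrite invr0 mulr0.
  by rewrite ler_pdivrMr ?ltr0n // mul1r (le_trans (ln_nat_sub1 _ _)) // gerBl.
have t3 y : (y <= 4)%N ->
    `|\sum_(1 <= n < y) chi n * (ln n%:R / n%:R)| <= 3.
  move=> y4; apply: le_trans (ler_norm_sum _ _ _) _.
  apply: (@le_trans _ _ (\sum_(1 <= n < y) 1)); first by apply: ler_sum => i _.
  by rewrite sumr_const_nat ler_nat; lia.
case: (leqP x.+1 4) => [/t3 h|x3].
  by apply: le_trans h _; rewrite lerDr.
(* ln t / t decreases only from e on, so the three terms below 4 are bounded separately and Abel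
   summation starts at 4. *)
rewrite (@big_cat_nat _ _ _ 4) //=; last by rewrite ltnW.
apply: le_trans (ler_normD _ _) _; rewrite addrC lerD ?t3 //.
apply: (@le_trans _ _ (M%:R * (ln 4%:R / 4%:R))); last first.
  rewrite ler_piMr // ler_pdivrMr ?ltr0n // mul1r.
  by rewrite (le_trans (ln_nat_sub1 _ _)) // gerBl.
apply: (@abel_bound R chi (fun n => ln n%:R / n%:R)) => [c _|n _|n n4].
- exact: rchi_sum_interval.
- by rewrite divr_ge0 ?ln_nat_ge0.
have n0 : (0 < n)%N by lia.
have n0R : 0 < n%:R :> R by rewrite ltr0n.
(* Since n (ln(n+1) - ln n) <= 1, ln n >= 1 suffices for ln n / n to decrease. It comes from ln 4 =
   2 ln 2 and ln 2 >= 1/2. *)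
have ln1 : 1 <= ln n%:R :> R.
  apply: (@le_trans _ _ (ln 4%:R)); last exact: ln_nat_le.
  have : ln 4%:R = 2 * ln 2%:R :> R.
    by rewrite (_ : 4%:R = 2%:R ^+ 2); [rewrite lnXn // mulr_natl | ring].
  have := @ln_natS_sub_ge R 1 isT; rewrite ln1.
  set a := ln 2%:R; lra.
have h := ln_natS_sub_le R n0.
rewrite ler_pdivrMr ?ltr0n // mulrAC ler_pdivlMr ?ltr0n //.
have : n%:R * (ln n.+1%:R - ln n%:R) <= 1 :> R.
  by rewrite -(ler_pM2l n0R) divff ?gt_eqF // in h.
rewrite -[in X in _ <= _ * X]natr1; move: ln1.
by set l := ln n.+1%:R; set l' := ln n%:R; clearbody l l'; lra.
Qed.

(** As chi is completely multiplicative, chi ln is the Dirichlet convolution of chi Lambda with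
    chi. *)
Lemma rchi_mangoldt_L x : \sum_(1 <= n < x.+1) chi n * (ln n%:R / n%:R) =
  \sum_(1 <= d < x.+1) chi d * (mangoldt R d / d%:R) * rchi_L (x %/ d).
Proof.
transitivity (\sum_(1 <= n < x.+1) \sum_(1 <= d < n.+1 | (d %| n)%N)
   chi d * (mangoldt R d / d%:R) * (chi (n %/ d)%N / (n %/ d)%:R)).
  apply: eq_big_nat => n /andP[n1 _].
  rewrite -sum_divisors_mangoldt // mulr_suml mulr_sumr.
  rewrite big_nat_cond [RHS]big_nat_cond.
  apply: eq_bigr => d /andP[/andP[d1 _] dn].
  move: (divnK dn); move: (n %/ d)%N => q <-.
  by rewrite (rchiM chiC) natrM invfM; ring.
rewrite (sum_divisors_exchange x
  (fun d m => chi d * (mangoldt R d / d%:R) * (chi m / m%:R))).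
by apply: eq_bigr => d _; rewrite mulr_sumr.
Qed.

(* Comparing L(x/d) with L(x) costs O(d/x), which Chebyshev's bound absorbs. *)
Lemma rchi_mangoldt_bounded :
  (exists2 c : R, 0 < c & exists x0, forall x, (x0 <= x)%N -> c <= `|rchi_L x|) ->
  exists C : R, forall x, `|\sum_(1 <= d < x.+1) chi d * (mangoldt R d / d%:R)| <= C.
Proof.
move=> [c c0 [x0 Lc]].
pose K := M%:R + 3 + M%:R * (4 * ln 2) : R.
have K0 : 0 <= K by rewrite !addr_ge0 // !mulr_ge0 // ln_nat_ge0.
have large x : (x0 <= x)%N ->
    `|\sum_(1 <= d < x.+1) chi d * (mangoldt R d / d%:R)| <= K / c.
  move=> xx0; rewrite ler_pdivlMr //.
  apply: le_trans (ler_wpM2l (normr_ge0 _) (Lc _ xx0)) _.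
  rewrite -normrM mulr_suml.
  have -> : \sum_(1 <= d < x.+1) chi d * (mangoldt R d / d%:R) * rchi_L x =
     \sum_(1 <= n < x.+1) chi n * (ln n%:R / n%:R) +
     \sum_(1 <= d < x.+1) chi d * (mangoldt R d / d%:R) * (rchi_L x - rchi_L (x %/ d)).
    rewrite rchi_mangoldt_L -big_split /=; apply: eq_bigr => d _; ring.
  apply: le_trans (ler_normD _ _) _; rewrite lerD ?rchi_ln_bounded //.
  case: x {xx0} => [|x]; first by rewrite big_geq // normr0 !mulr_ge0 // ln_nat_ge0.
  apply: le_trans (ler_norm_sum _ _ _) _.
  apply: (@le_trans _ _ (\sum_(1 <= d < x.+2) M%:R / x.+1%:R * mangoldt R d)).
    rewrite big_nat_cond [leRHS]big_nat_cond.
    apply: ler_sum => d /andP[/andP[d1 _] _]; rewrite !normrM.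
    rewrite (ger0_norm (mangoldt_ge0 _ _)) (ger0_norm (_ : 0 <= d%:R^-1)) ?invr_ge0 //.
    apply: (@le_trans _ _ (1 * (mangoldt R d / d%:R) * (M%:R / (x.+1 %/ d).+1%:R))).
      apply: ler_pM; rewrite ?mulr_ge0 ?invr_ge0 ?mangoldt_ge0 //.
        by rewrite ler_wpM2r ?rchi_norm // mulr_ge0 ?invr_ge0 ?mangoldt_ge0.
      by apply: rchi_L_sub; apply: leq_div.
    have -> : 1 * (mangoldt R d / d%:R) * (M%:R / (x.+1 %/ d).+1%:R) =
       (M%:R * mangoldt R d) * (d%:R * (x.+1 %/ d).+1%:R)^-1.
      by rewrite invfM; ring.
    rewrite [leRHS]mulrAC ler_wpM2l ?mulr_ge0 ?mangoldt_ge0 //.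
    rewrite lef_pV2 ?posrE ?mulr_gt0 ?ltr0n //.
    by rewrite -natrM ler_nat mulnC ltnW // ltn_ceil.
  rewrite -mulr_sumr -mulrA ler_wpM2l // mulrC ler_pdivrMr ?ltr0n //.
  exact: chebyshev_psi_le.
(* The added sum of absolute values takes care of the x below [x0]. *)
exists (K / c + \sum_(1 <= d < x0.+1) `|chi d * (mangoldt R d / d%:R)|) => x.
case: (leqP x0 x) => [/large h|xx0].
  by apply: le_trans h _; rewrite lerDl sumr_ge0.
apply: le_trans (ler_norm_sum _ _ _) _.
rewrite [X in _ <= _ + X](@big_cat_nat _ _ _ x.+1) //=; last by lia.
rewrite addrCA lerDl addr_ge0 ?sumr_ge0 // divr_ge0 // ltW //.
Qed.

End Character.

(** * Nonvanishing of L(1, chi) for real chi *)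

Section NonVanishing.
Variables (R : realType) (M : nat) (chi : nat -> R).
Hypothesis chiC : real_character M chi.

Definition rchi_divisor_sum n : R := \sum_(1 <= d < n.+1 | (d %| n)%N) chi d.

Local Notation r := rchi_divisor_sum.

Lemma rchi_divisor_sum1 : r 1 = 1.
Proof. by rewrite /r big_mkcond big_nat1 /= (rchi1 chiC). Qed.

(** The divisors of p^(a+1) m that are multiples of p are p times the divisors of p^a m; the others
    are the divisors of m. *)
Lemma rchi_divisor_sum_rec p a m : prime p -> ~~ (p %| m)%N -> (0 < m)%N ->
  r (p ^ a.+1 * m) = chi p * r (p ^ a * m) + r m.
Proof.
move=> pp pm m0; rewrite {1}/r (bigID (fun d => (p %| d)%N)) /=; congr (_ + _).
  rewrite expnS -mulnA; set N := (p ^ a * m)%N.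
  pose F e := if (e %| N)%N then chi (p * e)%N else 0.
  rewrite big_mkcondl /=.
  transitivity (\sum_(1 <= d < (p * N).+1 | (p %| d)%N) F (d %/ p)%N).
    apply: eq_bigr => d /divnK dp; rewrite -{1 2}dp mulnC /F.
    by rewrite dvdn_pmul2l ?prime_gt0.
  rewrite sum_multiples ?prime_gt0 // mulKn ?prime_gt0 // /r mulr_sumr.
  rewrite [RHS]big_mkcond /=; apply: eq_bigr => e _.
  by rewrite /F; case: ifP => // _; rewrite (rchiM chiC).
rewrite /r (big_nat_widen _ m.+1 (p ^ a.+1 * m).+1) ?ltnS ?leq_pmull //; last first.
  by rewrite expn_gt0 prime_gt0.
rewrite big_nat_cond [RHS]big_nat_cond; apply: eq_bigl => d.
case: (_ <= d < _)%N => //=; apply/andP/andP => [[dN pd]|[dm _]].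
  have dm : (d %| m)%N.
    by move: dN; rewrite Gauss_dvdr // coprime_sym coprimeXl // prime_coprime.
  by split; rewrite // ltnS dvdn_leq.
split; first exact: dvdn_mull.
by apply: contra pm => /dvdn_trans; apply.
Qed.

(** By the recurrence, r(p^a m) is r(m) times 1 if chi p = 0, times a + 1 if chi p = 1, and times 1
    or 0 by the parity of a if chi p = -1. *)
Lemma rchi_divisor_sum_pfactor p a m : prime p -> ~~ (p %| m)%N -> (0 < m)%N ->
  0 <= r m -> 0 <= r (p ^ a * m) /\ (~~ odd a -> r m <= r (p ^ a * m)).
Proof.
move=> pp pm m0 rm; have rec b := rchi_divisor_sum_rec b pp pm m0.
case: (rchi_val chiC p) => chip.
- by case: a => [|a]; rewrite ?expn0 ?mul1n // rec chip mul0r add0r.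
- suff h : r m <= r (p ^ a * m) by split=> // ; apply: le_trans h.
  elim: a => [|a IH]; first by rewrite mul1n.
  by rewrite rec chip mul1r lerDr; apply: le_trans IH.
- suff -> : r (p ^ a * m) = if odd a then 0 else r m by case: ifP.
  elim: a => [|a IH]; first by rewrite mul1n.
  by rewrite rec IH chip mulN1r /=; case: (odd a); rewrite /= ?oppr0 ?add0r ?addNr.
Qed.

(** The full power of the least prime factor is split off. If n is a square, its exponent is even
    and the cofactor is again a square. *)
Lemma rchi_divisor_sum_ge n : (0 < n)%N ->
  0 <= r n /\ (forall k, n = (k ^ 2)%N -> 1 <= r n).
Proof.
elim/ltn_ind: n => n IH n0; case: (leqP n 1) => [n1|n1].
  have -> : n = 1%N by lia.
  by rewrite rchi_divisor_sum1.
have pp := pdiv_prime n1; set p := pdiv n in pp.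
have [m pm En] := pfactor_coprime pp n0.
have m0 : (0 < m)%N by move: n0; rewrite En; case: (m).
have a0 : (0 < logn p n)%N by rewrite logn_gt0 mem_primes pp n0 pdiv_dvd.
have mn : (m < n)%N.
  by rewrite En ltn_Pmulr // -(expn0 p) ltn_exp2l ?prime_gt1.
have [r0 rsq] := IH m mn m0.
have pm' : ~~ (p %| m)%N by rewrite -prime_coprime.
have [h1 h2] := rchi_divisor_sum_pfactor (logn p n) pp pm' m0 r0.
rewrite mulnC -En in h1 h2; split=> // k Ek.
have k0 : (0 < k)%N by move: n0; rewrite Ek; case: (k).
have [l pl El] := pfactor_coprime pp k0.
have En' : logn p n = (logn p k * 2)%N by rewrite Ek lognX mulnC.
apply: le_trans (h2 _); last by rewrite En' oddM andbF.
apply: (rsq l).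
apply/eqP; rewrite -(eqn_pmul2r (_ : 0 < p ^ logn p n)%N); last first.
  by rewrite expn_gt0 prime_gt0.
by rewrite -En En' expnM -expnMn -El Ek.
Qed.

(** The weight N - n smooths the count of multiples of d into N^2/(2d) - N/2 + O(d). The term N/2 is
    the same for all d, so it only meets a bounded sum of chi. *)
Definition cesaro_sum N d : R := \sum_(1 <= m < (N %/ d).+1) (N%:R - (d * m)%:R).

Lemma cesaro_sum_term_ge0 N d m : (0 < d)%N -> (m < (N %/ d).+1)%N ->
  0 <= N%:R - (d * m)%:R :> R.
Proof.
by move=> d0 mN; rewrite subr_ge0 ler_nat mulnC -leq_divRL.
Qed.

Lemma cesaro_sum_ge0 N d : (0 < d)%N -> 0 <= cesaro_sum N d.
Proof.
move=> d0; rewrite /cesaro_sum big_nat_cond; apply: sumr_ge0.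
by move=> m /andP[/andP[_ mN] _]; apply: cesaro_sum_term_ge0.
Qed.

Lemma cesaro_sum_anti N d : (0 < d)%N -> cesaro_sum N d.+1 <= cesaro_sum N d.
Proof.
move=> d0; rewrite /cesaro_sum [leRHS](@big_cat_nat _ _ _ (N %/ d.+1).+1) //=; last first.
  by rewrite ltnS leq_div2l.
rewrite -[leLHS]addr0 lerD //.
  by apply: ler_sum => m _; rewrite lerD2l lerN2 ler_nat leq_mul2r leqnSn orbT.
rewrite big_nat_cond; apply: sumr_ge0.
by move=> m /andP[/andP[_ mN] _]; apply: cesaro_sum_term_ge0.
Qed.

Lemma cesaro_sum_le N d : (0 < d)%N -> cesaro_sum N d <= N%:R ^+ 2 / d%:R.
Proof.
move=> d0; apply: (@le_trans _ _ (\sum_(1 <= m < (N %/ d).+1) N%:R)).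
  by apply: ler_sum => m _; rewrite gerBl.
rewrite sumr_const_nat subn1 /= -[N%:R *+ _]mulr_natr expr2 -mulrA ler_wpM2l //.
by rewrite ler_pdivlMr ?ltr0n // -natrM ler_nat leq_trunc_div.
Qed.

(** With s = N mod d the error is exactly s (d - s) / (2d). *)
Lemma cesaro_sumE N d : (0 < d)%N ->
  `|cesaro_sum N d - (N%:R ^+ 2 / 2 / d%:R - N%:R / 2)| <= d%:R.
Proof.
move=> d0; have d0R : 0 < d%:R :> R by rewrite ltr0n.
pose q := (N %/ d)%N; pose s := (N %% d)%N.
have sd : s%:R <= d%:R :> R by rewrite ler_nat ltnW // ltn_mod.
have s0 : 0 <= s%:R :> R by [].
have E k : \sum_(1 <= m < k.+1) (N%:R - (d * m)%:R) =
    N%:R * k%:R - d%:R * (k%:R * (k%:R + 1) / 2) :> R.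
  elim: k => [|k IH]; first by rewrite big_geq //; ring.
  by rewrite big_nat_recr //= IH natrM -natr1; field.
have EN : N%:R = q%:R * d%:R + s%:R :> R by rewrite -natrM -natrD -divn_eq.
rewrite /cesaro_sum E -/q EN.
have -> : (q%:R * d%:R + s%:R) * q%:R - d%:R * (q%:R * (q%:R + 1) / 2) -
   ((q%:R * d%:R + s%:R) ^+ 2 / 2 / d%:R - (q%:R * d%:R + s%:R) / 2) =
   s%:R * (d%:R - s%:R) / (2 * d%:R) :> R.
  by move: d%:R q%:R s%:R d0R => D Q S D0; field; rewrite gt_eqF.
rewrite ger0_norm; last by rewrite divr_ge0 ?mulr_ge0 ?subr_ge0.
rewrite ler_pdivrMr ?mulr_gt0 //.
by move: d%:R s%:R d0R s0 sd => D S D0 S0 SD; nra.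
Qed.

Lemma sum_rchi_divisor_sum N :
  \sum_(1 <= n < N.+1) r n * (N%:R - n%:R) =
  \sum_(1 <= d < N.+1) chi d * cesaro_sum N d.
Proof.
transitivity (\sum_(1 <= n < N.+1) \sum_(1 <= d < n.+1 | (d %| n)%N)
   chi d * (N%:R - (d * (n %/ d))%:R)).
  apply: eq_bigr => n _; rewrite mulr_suml; apply: eq_bigr => d dn.
  by rewrite mulnC divnK.
rewrite (sum_divisors_exchange N (fun d m => chi d * (N%:R - (d * m)%:R))).
by apply: eq_bigr => d _; rewrite mulr_sumr.
Qed.

Lemma sum_rchi_divisor_sum_ge K : (1 < K)%N ->
  K%:R ^+ 3 / 3 <= \sum_(1 <= n < (K ^ 2).+1) r n * ((K ^ 2)%:R - n%:R).
Proof.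
move=> K1.
(* Only the squares n = k^2 are kept; their total (4K^3 - 3K^2 - K)/6 is at least K^3/3 once K >=
   2. *)
apply: (@le_trans _ _ (\sum_(1 <= k < K.+1) ((K ^ 2)%:R - (k ^ 2)%:R))).
  rewrite sumrB sumr_const_nat subn1 /= -[(K ^ 2)%:R *+ K]mulr_natr.
  have E k : \sum_(1 <= m < k.+1) (m ^ 2)%:R = k%:R * (k%:R + 1) * (2 * k%:R + 1) / 6 :> R.
    elim: k => [|k IH]; first by rewrite big_geq //; ring.
    by rewrite big_nat_recr //= IH natrX -natr1; field.
  rewrite E natrX; have : 2 <= K%:R :> R by rewrite ler_nat.
  move: K%:R => k k2; rewrite -subr_ge0.
  have -> : k ^+ 2 * k - k * (k + 1) * (2 * k + 1) / 6 - k ^+ 3 / 3 =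
    k * (2 * (k - 2) ^+ 2 + 5 * (k - 2) + 1) / 6 by field.
  have : 0 <= (k - 2) ^+ 2 by apply: sqr_ge0.
  by move=> ?; apply: divr_ge0 => //; apply: mulr_ge0; lra.
rewrite (eq_big_nat _ _ (F2 := fun k => \sum_(1 <= n < (K ^ 2).+1 | n == (k ^ 2)%N)
   ((K ^ 2)%:R - n%:R))); last first.
  move=> k /andP[k1 kK]; rewrite big_nat1_eq ltnS expn_gt0 k1 /=.
  by rewrite leq_exp2r // -ltnS kK.
under eq_bigr do rewrite big_mkcond.
rewrite exchange_big /= big_nat_cond [leRHS]big_nat_cond.
apply: ler_sum => n /andP[/andP[n1 nK] _].
have w0 : 0 <= (K ^ 2)%:R - n%:R :> R by rewrite subr_ge0 ler_nat -ltnS.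
have [r0 rsq] := rchi_divisor_sum_ge n1.
rewrite -big_mkcond /=.
case: (boolP (has (fun k => n == k ^ 2)%N (index_iota 1 K.+1))); last first.
  move/hasPn => h; rewrite big_seq_cond big_pred0 ?mulr_ge0 //.
  by move=> k; case: (boolP (k \in _)) => // /h /negPf.
case/hasP => k _ /eqP nk.
have -> : \sum_(1 <= i < K.+1 | n == (i ^ 2)%N) ((K ^ 2)%:R - n%:R) =
   \sum_(1 <= i < K.+1 | i == k) ((K ^ 2)%:R - n%:R) :> R.
  by apply: eq_bigl => i; rewrite nk eqn_exp2r // eq_sym.
rewrite big_nat1_eq; case: ifP => _; last by rewrite mulr_ge0.
by rewrite ler_peMl // (rsq k).
Qed.

(* With r = 1 * chi >= 0 and r >= 1 on squares, the sum of r(n)(N - n) over n <= N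
   is at least of order N^(3/2).  For N = y^6 it equals y^12 L(y^4) / 2 + O(y^8),
   so L(y^4) is at least of order y^-3, while L varies by O(y^-4) beyond y^4. *)
Lemma rchi_L_ge : exists2 c : R, 0 < c &
  exists x0, forall x, (x0 <= x)%N -> c <= rchi_L chi x.
Proof.
(* This y makes the lower bound y^9/3 equal to (3M + 2) y^8, while all errors together are at most
   (2M + 1) y^8. Hence y^12 L(x) / 2 >= 1. *)
pose y := (9 * M + 6)%N; have y0 : 0 < y%:R :> R by rewrite ltr0n /y addn_gt0 orbT.
exists (2 / y%:R ^+ 12); first by rewrite divr_gt0 ?exprn_gt0.
exists (y ^ 4)%N => x xD.
have h1 := @sum_rchi_divisor_sum_ge (y ^ 3).
have y31 : (1 < y ^ 3)%N by rewrite (ltn_exp2l 0) // /y; lia.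
move: {h1} (h1 y31); rewrite sum_rchi_divisor_sum -expnM.
rewrite [leRHS](@big_cat_nat _ _ _ (y ^ 4).+1) //=; last first.
  by rewrite ltnS leq_exp2l // /y; lia.
(* [cesaro_sum] decreases in d and is at most y^12 / y^4 beyond y^4, so Abel summation applies. *)
have tail : \sum_((y ^ 4).+1 <= d < (y ^ (3 * 2)).+1) chi d * cesaro_sum (y ^ (3 * 2)) d
    <= M%:R * y%:R ^+ 8.
  apply: le_trans (ler_norm _) _.
  apply: le_trans (abel_bound (B := M%:R) _ _ _ _) _.
  - by move=> c _; apply: rchi_sum_interval chiC _ _.
  - by move=> n n1; apply: cesaro_sum_ge0; apply: leq_ltn_trans n1.
  - by move=> n n1; apply: cesaro_sum_anti; apply: leq_ltn_trans n1.
  rewrite ler_wpM2l //; apply: le_trans (cesaro_sum_le _ _) _ => //.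
  rewrite ler_pdivrMr ?ltr0n // !natrX -!exprM.
  rewrite (_ : (3 * 2 * 2 = 8 + 4)%N) // exprD ler_wpM2l ?exprn_ge0 ?ltW //.
  by rewrite -natrX ltr_nat.
have main : \sum_(1 <= d < (y ^ 4).+1) chi d * cesaro_sum (y ^ (3 * 2)) d <=
   y%:R ^+ 12 / 2 * rchi_L chi (y ^ 4) + y%:R ^+ 6 / 2 * M%:R + y%:R ^+ 8.
  set N := (y ^ (3 * 2))%N.
  have -> : \sum_(1 <= d < (y ^ 4).+1) chi d * cesaro_sum N d =
     N%:R ^+ 2 / 2 * rchi_L chi (y ^ 4) - N%:R / 2 * \sum_(1 <= d < (y ^ 4).+1) chi d
     + \sum_(1 <= d < (y ^ 4).+1) chi d *
         (cesaro_sum N d - (N%:R ^+ 2 / 2 / d%:R - N%:R / 2)).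
    rewrite /rchi_L !mulr_sumr -sumrB -big_split /=; apply: eq_bigr => d _.
    by ring.
  have -> : y%:R ^+ 12 = N%:R ^+ 2 :> R by rewrite /N natrX -exprM.
  have -> : y%:R ^+ 6 = N%:R :> R by rewrite /N natrX.
  apply: lerD; first apply: lerD => //.
    rewrite -mulrN; apply: ler_wpM2l; first by rewrite divr_ge0.
    by apply: le_trans (ler_norm _) _; rewrite normrN; apply: rchi_sum_interval chiC _ _.
  apply: le_trans (ler_norm _) _; apply: le_trans (ler_norm_sum _ _ _) _.
  apply: (@le_trans _ _ (\sum_(1 <= d < (y ^ 4).+1) (y ^ 4)%:R)).
    rewrite big_nat_cond [leRHS]big_nat_cond; apply: ler_sum => d /andP[/andP[d1 dD] _].
    rewrite normrM; apply: (@le_trans _ _ (1 * d%:R)).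
      by apply: ler_pM => //; [apply: rchi_norm chiC _ | apply: cesaro_sumE].
    by rewrite mul1r ler_nat.
  by rewrite sumr_const_nat subn1 /= -mulrnA -expnD natrX.
have := rchi_L_sub chiC xD; rewrite ler_norml => /andP[h _].
have {}h : rchi_L chi (y ^ 4) <= rchi_L chi x + M%:R / y%:R ^+ 4.
  have : M%:R / (y ^ 4).+1%:R <= M%:R / y%:R ^+ 4 :> R.
    rewrite ler_wpM2l // lef_pV2 ?posrE ?ltr0n ?exprn_gt0 // -natrX ler_nat.
    exact: leqnSn.
  move=> h'; apply: le_trans (lerD (lexx _) h').
  by rewrite -lerBlDl -[leLHS]opprB lerNl.
have y12 : 0 < y%:R ^+ 12 :> R by rewrite exprn_gt0.
have y8 : 1 <= y%:R ^+ 8 :> R by rewrite exprn_ege1 // ler1n /y addn_gt0 orbT.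
move=> A; rewrite ler_pdivrMr //.
have {}h : y%:R ^+ 12 * rchi_L chi (y ^ 4) <=
    y%:R ^+ 12 * rchi_L chi x + M%:R * y%:R ^+ 8.
  apply: (le_trans (ler_wpM2l (ltW y12) h)).
  rewrite mulrDr lerD2l le_eqVlt; apply/orP; left; apply/eqP.
  by move: (y%:R) (M%:R) y0 => t u t0; field; rewrite gt_eqF.
have y68 : y%:R ^+ 6 <= y%:R ^+ 8 :> R.
  by rewrite ler_weXn2l // ler1n /y addn_gt0 orbT.
have y98 : (y ^ 3)%:R ^+ 3 = (9 * M%:R + 6) * y%:R ^+ 8 :> R.
  by rewrite natrX -exprM exprS /y natrD natrM.
rewrite y98 in A.
have {}y68 := ler_wpM2r (ler0n R M) y68.
have My8 : M%:R <= M%:R * y%:R ^+ 8 :> R by rewrite ler_peMr.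
have {A} := le_trans A (lerD main tail).
move: (ler0n R M) My8 y68 h y8 {tail main y98 y12 xD}.
move: (y%:R ^+ 12) (y%:R ^+ 8) (y%:R ^+ 6) (rchi_L chi x) (rchi_L chi (y ^ 4)) (M%:R).
move=> a b c d e m; clear; lra.
Qed.

End NonVanishing.

(** * Primes that are nonresidues for several moduli *)

Section QuadraticCharacters.
Variable R : realType.

(** Euler's criterion taken as definition: multiplicativity is immediate, and Fermat's little
    theorem restricts the power to 0, 1 and -1. *)
Definition legendre (q n : nat) : R :=
  let a := (n%:R : 'F_q) ^+ q.-1./2 in
  if a == 0 then 0 else if a == 1 then 1 else -1.

Definition chi4 (n : nat) : R := nth 0 [:: 0; 1; 0; -1] (n %% 4).

Lemma chi4_character : real_character 4 chi4.
Proof.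
split; last by exists 3%N => //; rewrite /chi4.
split=> // [m n|n|n].
- rewrite /chi4 -modnMm.
  have := ltn_pmod m (isT : 0 < 4)%N; have := ltn_pmod n (isT : 0 < 4)%N.
  case: (m %% 4)%N => [|[|[|[|//]]]] /=;
  by case: (n %% 4)%N => [|[|[|[|//]]]] //= _ _;
     rewrite ?mulr0 ?mul0r ?mulr1 ?mul1r ?mulrNN ?mulr1.
- by rewrite /chi4 modnDr.
- rewrite /chi4; have := ltn_pmod n (isT : 0 < 4)%N.
  by case: (n %% 4)%N => [|[|[|[|//]]]] /= _; constructor.
Qed.

Lemma legendre_character q : prime q -> odd q -> real_character q (legendre q).
Proof.
move=> pq oq; have q2 : (2 < q)%N by rewrite odd_prime_gt2.
have pF := pchar_Fp pq.
have hq : (q.-1./2 * 2 = q.-1)%N by lia.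
have n0 n : ((n%:R : 'F_q) == 0) = (q %| n)%N by rewrite (dvdn_pcharf pF).
have two0 : (2 : 'F_q) != 0 by rewrite n0; apply/negP => /dvdn_leq; lia.
have N10 : (-1 : 'F_q) != 0 by rewrite oppr_eq0 oner_eq0.
have N11 : (-1 : 'F_q) != 1.
  by apply: contra two0 => /eqP h; rewrite -[2]/(1 + 1) -{1}h addNr.
have fermat (x : 'F_q) : x != 0 -> x ^+ q.-1 = 1.
  move=> x0; have := expf_card x; rewrite card_Fp //.
  have -> : x ^+ q = x * x ^+ q.-1 by rewrite -exprS prednK ?prime_gt0.
  by move/(canRL (mulKf x0)); rewrite mulVf.
have val (x : 'F_q) : [\/ x ^+ q.-1./2 = 0, x ^+ q.-1./2 = 1 | x ^+ q.-1./2 = -1].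
  have [->|x0] := eqVneq x 0.
    by rewrite expr0n (_ : q.-1./2 == 0%N = false); [constructor | lia].
  have : (x ^+ q.-1./2) ^+ 2 == 1 by rewrite -exprM hq fermat.
  by rewrite sqrf_eq1; case/orP => /eqP ->; [constructor 2 | constructor 3].
split; last first.
  (* A nonresidue exists: X^((q-1)/2) - 1 has at most (q-1)/2 roots, fewer than the q - 1 units. *)
  have [x x0 hx] : exists2 x : 'F_q, x != 0 & x ^+ q.-1./2 != 1.
    apply: contrapT => nex.
    have h (x : 'F_q) : x != 0 -> x ^+ q.-1./2 = 1.
      by move=> x0; apply/eqP/negPn/negP => hx; apply: nex; exists x.
    have := @max_unity_roots _ q.-1./2 (enum [pred x : 'F_q | x != 0]).
    rewrite enum_uniq -cardE cardC1 card_Fp // => /(_ _ _ isT) H.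
    suff : (q.-1 <= q.-1./2)%N by lia.
    apply: H; first by lia.
    apply/allP => x; rewrite mem_enum => /h hx.
    exact/unity_rootP.
  exists (x : nat).
    by rewrite prime_coprime // -n0 natr_Zp.
  rewrite /legendre natr_Zp; case: (val x) hx => hv; rewrite hv ?eqxx //.
    by case/negP: x0; have := expf_eq0 x q.-1./2; rewrite hv eqxx => /esym/andP[].
  by rewrite (negPf N10) (negPf N11).
split=> [||m n|n|n].
- exact: prime_gt0.
- by rewrite /legendre expr1n oner_eq0 eqxx.
- have E := (eqxx, oner_eq0, negPf N10, negPf N11, mulr0, mul0r, mulr1, mul1r,
    mulrNN).
  rewrite /legendre natrM exprMn.
  by case: (val m%:R) => ->; case: (val n%:R) => ->; rewrite !E.
- by rewrite /legendre natrD (pcharf0 pF) addr0.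
- rewrite /legendre; case: (val n%:R) => ->;
  by rewrite ?eqxx ?oner_eq0 ?(negPf N10) ?(negPf N11); constructor.
Qed.

Lemma periodic_character1 : periodic_character 1 (fun=> 1 : R).
Proof. by split=> // [m n|n]; [rewrite mulr1 | constructor 2]. Qed.

Lemma periodic_characterM M N (chi psi : nat -> R) :
  periodic_character M chi -> periodic_character N psi ->
  periodic_character (M * N) (fun n => chi n * psi n).
Proof.
move=> c p; split=> [||m n|n|n].
- by rewrite muln_gt0 (rchi_mod_gt0 c) (rchi_mod_gt0 p).
- by rewrite (rchi1 c) (rchi1 p) mulr1.
- by rewrite (rchiM c) (rchiM p) mulrACA.
- congr (_ * _).
    by rewrite -[LHS](rchi_modn _ c) addnC mulnC modnMDl (rchi_modn _ c).
  by rewrite -[LHS](rchi_modn _ p) addnC modnMDl (rchi_modn _ p).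
- case: (rchi_val c n) => ->; rewrite ?mul0r ?mul1r ?mulN1r; first by constructor.
    exact: rchi_val p n.
  case: (rchi_val p n) => ->; rewrite ?oppr0 ?opprK; by constructor.
Qed.

Lemma real_characterM M N (chi psi : nat -> R) : coprime M N ->
  real_character M chi -> periodic_character N psi ->
  real_character (M * N) (fun n => chi n * psi n).
Proof.
move=> MN c p; split; first exact: (periodic_characterM c p).
have [a Ma chia] := rchi_nontrivial c.
(* A residue at which the first factor is -1 and the second is 1. *)
exists (chinese M N a 1).
  rewrite coprimeMl -coprime_modr chinese_modl // coprime_modr Ma.
  by rewrite -coprime_modr chinese_modr // coprime_modr coprimen1.
rewrite -(rchi_modn _ c) chinese_modl // (rchi_modn _ c) chia.
by rewrite -(rchi_modn _ p) chinese_modr // (rchi_modn _ p) (rchi1 p) mulr1.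
Qed.

Definition quad_char (q n : nat) : R := if q == 4 then chi4 n else legendre q n.

Definition quad_modulus (q : nat) := (q == 4) || (prime q && odd q).

Lemma quad_char_character q : quad_modulus q -> real_character q (quad_char q).
Proof.
rewrite /quad_modulus /quad_char => /orP[/eqP ->|/andP[pq oq]]; first exact: chi4_character.
by case: eqP oq => [->|_ oq] //; apply: legendre_character.
Qed.

Lemma quad_modulus_coprime (q q' : nat) :
  quad_modulus q -> quad_modulus q' -> q != q' ->
  coprime q q'.
Proof.
have c4 p : odd p -> coprime 4 p.
  by move=> op; apply: (@coprimeXl 2 2); rewrite coprime2n.
rewrite /quad_modulus => /orP[/eqP ->|/andP[pq oq]] /orP[/eqP ->|/andP[pq' oq']] //.
- by rewrite c4.
- by rewrite coprime_sym c4.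
- by rewrite prime_coprime // dvdn_prime2.
Qed.

Lemma quad_char_prod_periodic D : all quad_modulus D ->
  periodic_character (\prod_(q <- D) q) (fun n => \prod_(q <- D) quad_char q n).
Proof.
elim: D => [_|q D IH /= /andP[qm qD]].
  rewrite big_nil (_ : (fun n => _) = fun=> 1); first exact: periodic_character1.
  by apply/funext => n; rewrite big_nil.
rewrite big_cons (_ : (fun n => _) =
  fun n => quad_char q n * \prod_(q <- D) quad_char q n); last first.
  by apply/funext => n; rewrite big_cons.
exact: periodic_characterM (quad_char_character qm) (IH qD).
Qed.

(** The moduli are pairwise coprime, so the Chinese remainder theorem keeps every nonempty product
    of distinct characters nonprincipal. *)
Lemma quad_char_prod_real D : D != [::] -> uniq D -> all quad_modulus D ->
  real_character (\prod_(q <- D) q) (fun n => \prod_(q <- D) quad_char q n).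
Proof.
case: D => // q D _ /= /andP[qD uD] /andP[qm Dm].
rewrite big_cons (_ : (fun n => _) =
  fun n => quad_char q n * \prod_(q <- D) quad_char q n); last first.
  by apply/funext => n; rewrite big_cons.
apply: real_characterM (quad_char_character qm) (quad_char_prod_periodic Dm).
rewrite big_seq; elim/big_ind: _ => [|m n|q' q'D]; first exact: coprimen1.
  by rewrite coprimeMr => -> ->.
apply: quad_modulus_coprime => //; first exact: (allP Dm).
by apply: contraNneq qD => ->.
Qed.

Lemma quad_char_prod_mangoldt_bounded D :
  D != [::] -> uniq D -> all quad_modulus D -> exists C : R, forall x,
    `|\sum_(1 <= d < x.+1) (\prod_(q <- D) quad_char q d) * (mangoldt R d / d%:R)|
      <= C.
Proof.
move=> D0 uD Dm; have c := quad_char_prod_real D0 uD Dm.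
apply: (rchi_mangoldt_bounded c).
have [e e0 [x0 ex]] := rchi_L_ge c.
exists e => //; exists x0 => x /ex h; apply: le_trans h (ler_norm _).
Qed.

(** On primes exceeding all moduli in s this is 2^(size s) times the indicator of being a nonresidue
    for every one of them. *)
Definition quad_weight s n : R := \prod_(q <- s) (1 - quad_char q n).

(* Multiplying out the factors of the weight one at a time keeps every error
   term a sum over a nonprincipal character. *)
Lemma quad_weight_twist_bounded s D :
  D != [::] -> uniq (s ++ D) -> all quad_modulus (s ++ D) -> exists C : R, forall x,
    `|\sum_(1 <= d < x.+1)
       quad_weight s d * (\prod_(q <- D) quad_char q d) * (mangoldt R d / d%:R)| <= C.
Proof.
elim: s D => [|q s IH] D D0 uD Dm.
  have [C hC] := quad_char_prod_mangoldt_bounded D0 uD Dm; exists C => x.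
  by under eq_bigr do rewrite /quad_weight big_nil mul1r.
have /= /andP[qsD usD] := uD; have /= /andP[qm sDm] := Dm.
have [C1 h1] := IH D D0 usD sDm.
have perm : perm_eq (s ++ q :: D) (q :: s ++ D).
  by rewrite -cat1s -[q :: s ++ D]cat1s perm_catCA.
have [||C2 h2] := IH (q :: D) isT.
- by rewrite (perm_uniq perm).
- by rewrite (perm_all _ perm).
exists (C1 + C2) => x.
have -> : \sum_(1 <= d < x.+1) quad_weight (q :: s) d *
     (\prod_(q <- D) quad_char q d) * (mangoldt R d / d%:R) =
  \sum_(1 <= d < x.+1) quad_weight s d *
     (\prod_(q <- D) quad_char q d) * (mangoldt R d / d%:R) -
  \sum_(1 <= d < x.+1) quad_weight s d *
     (\prod_(q <- q :: D) quad_char q d) * (mangoldt R d / d%:R).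
  by rewrite -sumrB; apply: eq_bigr => d _; rewrite /quad_weight !big_cons; ring.
by apply: le_trans (ler_normB _ _) (lerD (h1 x) (h2 x)).
Qed.

(** When the factors 1 - chi_q are opened one by one, the leading 1 yields Mertens' ln x and each
    term carrying chi_q stays bounded. *)
Lemma quad_weight_mangoldt_ge s : uniq s -> all quad_modulus s ->
  exists C : R, forall x, (0 < x)%N ->
    ln x%:R - C <= \sum_(1 <= d < x.+1) quad_weight s d * (mangoldt R d / d%:R).
Proof.
elim: s => [_ _|q s IH /= /andP[qs us] /andP[qm sm]].
  exists 1 => x x0; under eq_bigr do rewrite /quad_weight big_nil mul1r.
  exact: sum_mangoldt_div_ge.
have [C1 h1] := IH us sm.
have [||C2 h2] := @quad_weight_twist_bounded s [:: q] isT.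
- by rewrite cats1 rcons_uniq qs.
- by rewrite cats1 all_rcons qm.
exists (C1 + C2) => x x0.
have -> : \sum_(1 <= d < x.+1) quad_weight (q :: s) d * (mangoldt R d / d%:R) =
  \sum_(1 <= d < x.+1) quad_weight s d * (mangoldt R d / d%:R) -
  \sum_(1 <= d < x.+1) quad_weight s d *
     (\prod_(q <- [:: q]) quad_char q d) * (mangoldt R d / d%:R).
  rewrite -sumrB; apply: eq_bigr => d _.
  by rewrite /quad_weight !big_cons big_nil; ring.
have := h1 x x0; have := h2 x; rewrite ler_norml => /andP[_].
rewrite opprD addrA => a b; apply: lerB => //.
Qed.

Definition quad_nonresidue s p := all (fun q => quad_char q p == -1) s.

Lemma quad_weight_bounds s n : all quad_modulus s ->
  0 <= quad_weight s n <= 2 ^+ size s.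
Proof.
elim: s => [_|q s IH /= /andP[qm /IH/andP[w0 w1]]].
  by rewrite /quad_weight big_nil ler01 lexx.
rewrite /quad_weight big_cons exprS.
have := rchi_norm (quad_char_character qm) n; rewrite ler_norml => /andP[a b].
by rewrite mulr_ge0 ?subr_ge0 //= ler_pM ?subr_ge0 // lerBlDr -lerBlDl; lra.
Qed.

Lemma rchiX M (chi : nat -> R) n k :
  periodic_character M chi -> chi (n ^ k)%N = chi n ^+ k.
Proof.
move=> c; elim: k => [|k IH]; first by rewrite (rchi1 c).
by rewrite expnS (rchiM c) IH exprS.
Qed.

(** By Euler's theorem some positive power of chi n equals chi 1 = 1. *)
Lemma rchi_coprime_neq0 M (chi : nat -> R) n :
  periodic_character M chi -> coprime n M -> chi n != 0.
Proof.
move=> c nM; apply/eqP => chi0.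
have t0 : (0 < totient M)%N by rewrite totient_gt0 (rchi_mod_gt0 c).
have : chi (n ^ totient M)%N = 1.
  by rewrite -(rchi_modn _ c) Euler_exp_totient // (rchi_modn _ c) (rchi1 c).
rewrite (rchiX _ _ c) chi0 expr0n eqn0Ngt t0 /= => /eqP.
by rewrite eq_sym oner_eq0.
Qed.

Lemma quad_weight_prime s p :
  prime p -> all quad_modulus s -> all (fun q => q < p)%N s ->
  quad_weight s p = if quad_nonresidue s p then 2 ^+ size s else 0.
Proof.
move=> pp; elim: s => [_ _|q s IH /= /andP[qm sm] /andP[qp sp]].
  by rewrite /quad_weight big_nil.
rewrite /quad_weight big_cons -/(quad_weight s p) IH //.
have c := quad_char_character qm.
have : quad_char q p != 0.
  apply: (rchi_coprime_neq0 c); rewrite prime_coprime //.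
  by apply/negP => /(dvdn_leq (rchi_mod_gt0 c)); rewrite leqNgt qp.
case: (rchi_val c p) => -> //.
- by rewrite eqxx.
- by rewrite subrr mul0r (gt_eqF (lt_trans (ltrN10 R) ltr01)).
- by rewrite eqxx opprK /= => _; case: ifP; rewrite ?mulr0 // exprS.
Qed.

Lemma sum_inv_nonresidue_interval s : uniq s -> all quad_modulus s ->
  exists2 h, (0 < h)%N & exists u0, forall u, (u0 <= u)%N ->
  h%:R^-1 <= \sum_(u.+1 <= p < (u ^ h).+1 | prime p && quad_nonresidue s p) p%:R^-1 :> R.
Proof.
move=> us sm; have [C hC] := quad_weight_mangoldt_ge us sm.
(* B bounds the weight. Of the h ln u = 3 B ln u supplied up to u^h, the d <= u and the error terms
   take at most 2 B ln u. The primes keep B ln u, which is at most B h ln u times the sum of 1/p, as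
   ln p <= h ln u. *)
pose B := (2 ^ size s)%N; pose h := (3 * B)%N.
have B0 : (0 < B)%N by rewrite expn_gt0.
have h0 : (0 < h)%N by rewrite muln_gt0.
exists h => //.
pose C' := (C + B%:R * (4 * ln 2 + 4)) / B%:R.
(* These bounds on u give ln u > 0, p > q for every q in s, and ln u >= [C']. *)
exists (maxn (maxn 2 (\max_(q <- s) q)) (Num.bound (expR C'))) => u.
rewrite !geq_max -andbA => /and3P[u2 usm uC].
have u0 : (0 < u)%N by lia.
have lu0 : 0 < ln u%:R :> R by rewrite ln_gt0 // ltr1n.
have su : all (fun q => q <= u)%N s.
  apply/allP => q qs; apply: leq_trans usm.
  by rewrite (big_rem q) //= leq_maxl.
have luC : C' <= ln u%:R.
  rewrite -[C']expRK ler_ln ?posrE ?expR_gt0 ?ltr0n //.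
  apply: le_trans (ltW (archi_boundP (expR_ge0 _))) _.
  by rewrite ler_nat.
have uh : (u <= u ^ h)%N by rewrite -[X in (X <= _)%N]expn1 leq_pexp2l.
have v0 : (0 < u ^ h)%N by rewrite expn_gt0 u0.
set v := (u ^ h)%N in uh v0 *.
have lv : ln v%:R = h%:R * ln u%:R :> R.
  by rewrite natrX lnXn ?ltr0n // mulr_natl.
have BE : B%:R = 2 ^+ size s :> R by rewrite natrX.
have wB n : quad_weight s n <= B%:R by rewrite BE; case/andP: (quad_weight_bounds n sm).
have w0 n : 0 <= quad_weight s n by case/andP: (quad_weight_bounds n sm).
have md0 d : 0 <= mangoldt R d / d%:R by rewrite divr_ge0 // mangoldt_ge0.
have := hC v v0.
rewrite (@big_cat_nat _ _ _ u.+1) //=.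
have small : \sum_(1 <= d < u.+1) quad_weight s d * (mangoldt R d / d%:R) <=
    B%:R * (ln u%:R + 4 * ln 2).
  apply: (@le_trans _ _ (B%:R * \sum_(1 <= d < u.+1) mangoldt R d / d%:R)).
    by rewrite mulr_sumr; apply: ler_sum => d _; rewrite ler_wpM2r.
  by rewrite ler_wpM2l // sum_mangoldt_div_le.
rewrite [\sum_(u.+1 <= d < v.+1) _](bigID prime) /=.
have nonprime : \sum_(u.+1 <= d < v.+1 | ~~ prime d)
    quad_weight s d * (mangoldt R d / d%:R) <= B%:R * 4.
  apply: (@le_trans _ _ (B%:R * \sum_(1 <= d < v.+1 | ~~ prime d) mangoldt R d / d%:R)).
    rewrite [X in _ <= _ * X](@big_cat_nat _ _ _ u.+1) //= mulrDr.
    rewrite -[leLHS]add0r lerD ?mulr_ge0 ?sumr_ge0 //.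
    by rewrite mulr_sumr; apply: ler_sum => d _; rewrite ler_wpM2r.
  by rewrite ler_wpM2l // sum_mangoldt_nonprime_le.
set S := \sum_(_ <= p < _ | prime p && _) _.
have primes : \sum_(u.+1 <= d < v.+1 | prime d)
    quad_weight s d * (mangoldt R d / d%:R) <= B%:R * (h%:R * ln u%:R) * S.
  rewrite /S big_mkcondr mulr_sumr big_nat_cond [leRHS]big_nat_cond.
  apply: ler_sum => p /andP[/andP[up pv] pp].
  rewrite quad_weight_prime //; last first.
    by apply: sub_all su => q qu; apply: leq_ltn_trans up.
  case: ifP => _; last by rewrite mul0r mulr0.
  rewrite -BE -mulrA ler_wpM2l // mangoldt_prime // ler_wpM2r ?invr_ge0 //.
  by rewrite -lv ln_nat_le ?prime_gt0.
rewrite lv => A.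
have B0R : 0 < B%:R :> R by rewrite ltr0n.
have h0R : 0 < h%:R :> R by rewrite ltr0n.
have hE : h%:R = 3 * B%:R :> R by rewrite natrM.
rewrite -(ler_pM2l (mulr_gt0 B0R (mulr_gt0 h0R lu0))).
rewrite [leLHS](_ : _ = B%:R * ln u%:R); last by field; rewrite gt_eqF.
have {luC} : C + B%:R * (4 * ln 2 + 4) <= B%:R * ln u%:R.
  by rewrite [leRHS]mulrC -ler_pdivrMr.
move=> luC; apply: le_trans primes; move: A small nonprime luC; rewrite hE.
set X := \sum_(1 <= d < u.+1) _.
set Y := \sum_(_ <= d < _ | ~~ _) _.
set Z := \sum_(_ <= d < _ | prime d) _.
move: (ln u%:R) (ln 2) B%:R X Y Z => a b c x y z; clear; lra.
Qed.

(** Since h does not depend on u, consecutive intervals (u^E, u^(E h)] each contribute 1/h, and K h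
    of them reach K. *)
Lemma sum_inv_nonresidue_ge s (K : nat) : uniq s -> all quad_modulus s ->
  exists2 E, (0 < E)%N & exists u0, forall u, (u0 <= u)%N ->
  K%:R <= \sum_(u.+1 <= p < (u ^ E).+1 | prime p && quad_nonresidue s p) p%:R^-1 :> R.
Proof.
move=> us sm; have [h h0 [u0 hu]] := sum_inv_nonresidue_interval us sm.
suff H r : exists2 E, (0 < E)%N & forall u, (maxn 1 u0 <= u)%N -> r%:R / h%:R <=
    \sum_(u.+1 <= p < (u ^ E).+1 | prime p && quad_nonresidue s p) p%:R^-1 :> R.
  have [E E0 HE] := H (K * h)%N; exists E => //; exists (maxn 1 u0) => u /HE.
  by rewrite natrM mulfK // pnatr_eq0 -lt0n.
elim: r => [|r [E E0 IH]].
  by exists 1%N => // u _; rewrite mul0r sumr_ge0 // => p _; rewrite invr_ge0.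
exists (E * h)%N; first by rewrite muln_gt0 E0.
move=> u uu; have u1 : (0 < u)%N by move: uu; rewrite geq_max => /andP[].
have uE : (u <= u ^ E)%N by rewrite -[X in (X <= _)%N]expn1 leq_pexp2l.
rewrite (@big_cat_nat _ _ _ (u ^ E).+1) //=; last first.
  by rewrite ltnS expnM -[X in (X <= _)%N]expn1 leq_pexp2l // expn_gt0 u1.
rewrite -natr1 mulrDl mul1r lerD ?IH // expnM hu //.
by apply: leq_trans uE; move: uu; rewrite geq_max => /andP[].
Qed.

End QuadraticCharacters.

(** If q divides p - 1, then p is 1 mod q and its character value is 1 instead of -1. *)
Lemma quad_nonresidue_dvd (R : realType) (s : seq nat) (p : nat) :
  all quad_modulus s -> quad_nonresidue R s p -> (0 < p)%N ->
  {in s, forall q, ~~ (q %| p.-1)%N}.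
Proof.
move=> sm nr p0 q qs; apply/negP => /dvdnP[k pk].
have c := quad_char_character R (allP sm _ qs).
have := allP nr q qs; rewrite -[p](prednK p0) pk -addn1.
rewrite -(rchi_modn _ c) modnMDl (rchi_modn _ c) (rchi1 c).
by rewrite (gt_eqF (lt_trans (ltrN10 R) ltr01)).
Qed.

Lemma four_or_odd_prime_dvd d : (2 < d)%N ->
  (4 %| d)%N \/ exists q, [/\ prime q, odd q & (q %| d)%N].
Proof.
move=> d2; have d0 : (0 < d)%N by lia.
have [m om Ed] := pfactor_coprime (isT : prime 2) d0.
rewrite coprime2n in om.
have [m1|m1] := leqP m 1.
  have {}m1 : m = 1%N by move: om m1; case: (m) => [|[|]].
  left; rewrite Ed m1 mul1n (@dvdn_exp2l 2 2) // leqNgt; apply/negP => l2.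
  by move: d2; rewrite Ed m1 mul1n; case: (logn 2 d) l2 => [|[|]].
right; exists (pdiv m); split; first exact: pdiv_prime.
  by apply: dvdn_odd (pdiv_dvd m) om.
by rewrite Ed dvdn_mulr // pdiv_dvd.
Qed.

Definition quad_moduli n0 := 4%N :: [seq q <- iota 1 n0 | prime q && odd q].

Lemma quad_moduli_uniq n0 : uniq (quad_moduli n0).
Proof.
by rewrite /= mem_filter /= filter_uniq // iota_uniq.
Qed.

Lemma quad_moduli_all n0 : all quad_modulus (quad_moduli n0).
Proof.
apply/allP => q; rewrite in_cons => /orP[/eqP ->//|]; rewrite mem_filter => /andP[h _].
by rewrite /quad_modulus h orbT.
Qed.

(** A divisor d > 2 of p - 1 is a multiple of 4 or of an odd prime; for d <= n0 this would be one of
    the moduli. *)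
Lemma quad_nonresidue_small_divisor (R : realType) n0 p d :
  prime p -> quad_nonresidue R (quad_moduli n0) p ->
  (d %| p.-1)%N -> (0 < d <= n0)%N -> (d <= 2)%N.
Proof.
move=> pp nr dp /andP[d0 dn0]; rewrite leqNgt; apply/negP => d2.
have nd := quad_nonresidue_dvd (quad_moduli_all n0) nr (prime_gt0 pp).
have [d4|[q [pq oq qd]]] := four_or_odd_prime_dvd d2.
  by move: (nd 4%N (mem_head _ _)); rewrite (dvdn_trans d4).
have qs : q \in quad_moduli n0.
  rewrite in_cons mem_filter pq oq mem_iota prime_gt0 //= add1n ltnS.
  by rewrite (leq_trans (dvdn_leq d0 qd)) ?orbT.
by move: (nd q qs); rewrite (dvdn_trans qd).
Qed.

(** * Sieve estimates *)

Section Sieve.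
Variable R : realType.
Implicit Types (t : pred nat) (x z n p k d : nat).

Lemma count_multiples d x : (0 < d)%N ->
  \sum_(1 <= n < x.+1) (d %| n)%N%:R = (x %/ d)%:R :> R.
Proof.
move=> d0; under eq_bigr do rewrite mulrb.
rewrite -big_mkcond (sum_multiples x (fun=> 1 : R) d0).
by rewrite sumr_const_nat subn1.
Qed.

Lemma count_multiples_le d x : (0 < d)%N ->
  \sum_(1 <= n < x.+1) (d %| n)%N%:R <= x%:R / d%:R :> R.
Proof.
move=> d0; rewrite count_multiples // ler_pdivlMr ?ltr0n //.
by rewrite -natrM ler_nat leq_trunc_div.
Qed.

(* Turan's second-moment argument: the number of prime divisors of n satisfying
   t has mean mu and variance at most 3 mu. *)
Lemma turan_sieve t z x :
  let mu := \sum_(z.+1 <= p < x.+1 | prime p && t p) p%:R^-1 : R in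
  0 < mu ->
  \sum_(1 <= n < x.+1)
    (~~ has (fun p => [&& prime p, t p & (p %| n)%N]) (index_iota z.+1 x.+1))%:R
    <= 3 * x%:R / mu.
Proof.
move=> mu mu0.
pose w n : R := \sum_(z.+1 <= p < x.+1 | prime p && t p) (p %| n)%N%:R.
(* Rounding down costs at most 1 for each of at most x values of p. *)
have w1 : x%:R * mu - x%:R <= \sum_(1 <= n < x.+1) w n.
  rewrite /w exchange_big /= /mu mulr_sumr.
  apply: (@le_trans _ _ (\sum_(z.+1 <= p < x.+1 | prime p && t p) (x%:R / p%:R - 1))).
    rewrite sumrB lerB // big_mkcond /=.
    apply: (@le_trans _ _ (\sum_(z.+1 <= p < x.+1) 1)).
      by apply: ler_sum => p _; case: ifP.
    by rewrite sumr_const_nat ler_nat subSS leq_subr.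
  apply: ler_sum => p /andP[pp _]; rewrite count_multiples ?prime_gt0 //.
  rewrite lerBlDr ler_pdivrMr ?ltr0n ?prime_gt0 // natr1 -natrM ler_nat.
  by rewrite ltnW // ltn_ceil ?prime_gt0.
have w2 : \sum_(1 <= n < x.+1) w n ^+ 2 <= x%:R * mu ^+ 2 + x%:R * mu.
  have -> : \sum_(1 <= n < x.+1) w n ^+ 2 =
    \sum_(z.+1 <= p < x.+1 | prime p && t p) \sum_(z.+1 <= q < x.+1 | prime q && t q)
      \sum_(1 <= n < x.+1) ((p %| n)%N && (q %| n)%N)%:R.
    under [RHS]eq_bigr do rewrite exchange_big /=.
    rewrite [RHS]exchange_big /=; apply: eq_bigr => n _.
    rewrite expr2 /w mulr_suml; apply: eq_bigr => p _.
    by rewrite mulr_sumr; apply: eq_bigr => q _; rewrite -natrM mulnb.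
  have -> : x%:R * mu ^+ 2 + x%:R * mu =
    \sum_(z.+1 <= p < x.+1 | prime p && t p) \sum_(z.+1 <= q < x.+1 | prime q && t q)
      (x%:R / (p%:R * q%:R) + if q == p then x%:R / p%:R else 0).
    under [RHS]eq_bigr => p _ do rewrite big_split /=.
    rewrite big_split /=; congr (_ + _).
      rewrite expr2 /mu mulrA [x%:R * _]mulr_sumr mulr_suml; apply: eq_bigr => p _.
      by rewrite mulr_sumr; apply: eq_bigr => q _; rewrite invfM mulrA.
    rewrite /mu mulr_sumr [LHS]big_nat_cond [RHS]big_nat_cond.
    apply: eq_bigr => p /andP[pz pt].
    rewrite -big_mkcondr /= (big_nat1_cond_eq _ (fun=> x%:R / p%:R)
      (fun q => prime q && t q)).
    by rewrite pz pt.
  apply: ler_sum => p /andP[pp _]; apply: ler_sum => q /andP[pq _].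
  have [->|qp] := eqVneq q p.
    under eq_bigr do rewrite andbb.
    apply: le_trans (count_multiples_le _ (prime_gt0 pp)) _.
    by rewrite lerDr divr_ge0 ?mulr_ge0.
  rewrite addr0 -natrM; apply: le_trans (count_multiples_le _ _); last first.
    by rewrite muln_gt0 !prime_gt0.
  apply: ler_sum => n _; rewrite Gauss_dvd //.
  by rewrite prime_coprime // dvdn_prime2 // eq_sym.
(* Chebyshev's inequality: an n without such a prime has w n = 0 and contributes mu^2 to the sum of
   (w n - mu)^2, which is at most x mu^2 + x mu - 2 mu (x mu - x) + x mu^2 = 3 x mu. *)
rewrite ler_pdivlMr // -(ler_pM2r mu0) -mulrA -expr2.
apply: (@le_trans _ _ (\sum_(1 <= n < x.+1) (w n - mu) ^+ 2)).
  rewrite mulr_suml; apply: ler_sum => n _.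
  case: hasP => [_|h] /=; first by rewrite mul0r sqr_ge0.
  rewrite mul1r (_ : w n = 0) ?sub0r ?sqrrN //.
  rewrite /w big_seq_cond big1 // => p /andP[pz /andP[pp tp]].
  by case: (boolP (p %| n)%N) => // pn; case: h; exists p => //; rewrite pp tp.
have -> : \sum_(1 <= n < x.+1) (w n - mu) ^+ 2 =
  \sum_(1 <= n < x.+1) w n ^+ 2 - 2 * mu * \sum_(1 <= n < x.+1) w n + x%:R * mu ^+ 2.
  have -> : x%:R * mu ^+ 2 = \sum_(1 <= n < x.+1) mu ^+ 2.
    by rewrite sumr_const_nat subn1 /= mulr_natl.
  rewrite mulr_sumr -sumrB -big_split /=; apply: eq_bigr => n _; ring.
have := ler_wpM2l (ltW mu0) w1.
move: w2; set X := \sum_(1 <= n < x.+1) w n ^+ 2; set Y := \sum_(1 <= n < x.+1) w n.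
move: X Y (x%:R : R) => X Y c; move: {w w1 mu0}mu => m; lra.
Qed.

Lemma sum_inv_sqr_tail z x : (0 < z)%N ->
  \sum_(z.+1 <= p < x.+1) (p%:R ^+ 2)^-1 <= z%:R^-1 :> R.
Proof.
move=> z0; have [zx|xz] := leqP z x; last by rewrite big_geq ?invr_ge0 // ltnW.
suff : \sum_(z.+1 <= p < x.+1) (p%:R ^+ 2)^-1 <= z%:R^-1 - x%:R^-1 :> R.
  by move=> /le_trans; apply; rewrite gerBl invr_ge0.
elim: x zx => [|x IH]; first by case: z z0.
rewrite leq_eqVlt => /orP[/eqP <-|]; first by rewrite big_geq // subrr.
rewrite ltnS => zx; rewrite big_nat_recr //=.
apply: le_trans (lerD (IH zx) (lexx _)) _.
rewrite -addrA lerD2l; have x0 : 0 < x%:R :> R by rewrite ltr0n; apply: leq_trans zx.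
rewrite -subr_ge0 -natr1; move: x%:R x0 => a a0.
have -> : - (a + 1)^-1 - (- a^-1 + ((a + 1) ^+ 2)^-1) = (a * (a + 1) ^+ 2)^-1.
  by field; rewrite !gt_eqF // addr_gt0.
by rewrite invr_ge0 mulr_ge0 ?exprn_ge0 ?addr_ge0 // ltW.
Qed.

(* Counts the ways in which a prime p > z dividing n can fail to give a normal
   Sylow subgroup of order p: either p^2 divides n, or n has a divisor kp + 1. *)
Definition sylow_defect z x n : R :=
  \sum_(z.+1 <= p < x.+1) (p ^ 2 %| n)%N%:R +
  \sum_(z.+1 <= p < x.+1) \sum_(1 <= k < x.+1) (p * (k * p).+1 %| n)%N%:R.

(** At most x/p^2 integers are multiples of p^2 and at most x/(p^2 k) of p (kp + 1). Summing 1/k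
    gives 1 + ln x, and summing 1/p^2 over p > z gives 1/z. *)
Lemma sum_sylow_defect_le z x : (0 < z)%N -> (0 < x)%N ->
  \sum_(1 <= n < x.+1) sylow_defect z x n <= x%:R * (2 + ln x%:R) / z%:R.
Proof.
move=> z0 x0; rewrite big_split /=.
pose S := \sum_(z.+1 <= p < x.+1) (p%:R ^+ 2)^-1 : R.
have Sz : S <= z%:R^-1 by apply: sum_inv_sqr_tail.
have S0 : 0 <= S by apply: sumr_ge0 => p _; rewrite invr_ge0 exprn_ge0.
have l0 : 0 <= ln x%:R :> R by apply: ln_nat_ge0.
apply: (@le_trans _ _ (x%:R * S + x%:R * S * (1 + ln x%:R))); last first.
  rewrite -[leRHS]mulrA [leLHS](_ : _ = x%:R * ((2 + ln x%:R) * S)); last by ring.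
  by apply: ler_wpM2l => //; apply: ler_wpM2l => //; apply: addr_ge0.
apply: lerD.
  rewrite exchange_big /= /S mulr_sumr big_nat_cond [leRHS]big_nat_cond.
  apply: ler_sum => p /andP[/andP[zp _] _]; rewrite -natrX.
  by apply: count_multiples_le; rewrite expn_gt0 (leq_ltn_trans _ zp).
rewrite exchange_big /= /S mulr_sumr mulr_suml big_nat_cond [leRHS]big_nat_cond.
apply: ler_sum => p /andP[/andP[zp _] _]; rewrite exchange_big /=.
have p0 : (0 < p)%N by apply: leq_ltn_trans zp.
apply: le_trans (ler_wpM2l _ (harmonic_le R x0)); last by rewrite divr_ge0 ?exprn_ge0.
rewrite mulr_sumr big_nat_cond [leRHS]big_nat_cond.
apply: ler_sum => k /andP[/andP[k1 _] _].
apply: le_trans (count_multiples_le _ _) _; first by rewrite muln_gt0 p0.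
rewrite -mulrA -invfM ler_wpM2l // -natrX -natrM lef_pV2 ?posrE ?ltr0n; last 2 first.
- by rewrite muln_gt0 p0.
- by rewrite muln_gt0 expn_gt0 p0.
by rewrite ler_nat expnS expn1 -mulnA leq_mul2l mulnC leqnSn orbT.
Qed.

Lemma sylow_defect_ge0 z x n : 0 <= sylow_defect z x n.
Proof. by rewrite addr_ge0 ?sumr_ge0 // => p _; apply: sumr_ge0. Qed.

Lemma le_sum_nat_term (F : nat -> R) (a b i : nat) :
  (forall j, 0 <= F j) -> (a <= i < b)%N -> F i <= \sum_(a <= j < b) F j.
Proof.
move=> F0 iab; rewrite (bigD1_seq i) ?mem_index_iota ?iota_uniq //=.
by rewrite lerDl sumr_ge0.
Qed.

Lemma sylow_defect_sqr z x n p : (z < p < x.+1)%N -> (p ^ 2 %| n)%N ->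
  1 <= sylow_defect z x n.
Proof.
move=> pzx pn; apply: (@le_trans _ _ (\sum_(z.+1 <= q < x.+1) (q ^ 2 %| n)%N%:R)).
  by apply: le_trans (le_sum_nat_term _ pzx); rewrite ?pn.
by rewrite lerDl sumr_ge0 // => q _; apply: sumr_ge0.
Qed.

Lemma sylow_defect_dvd z x n p k : (z < p < x.+1)%N -> (0 < n <= x)%N ->
  (0 < k)%N -> (p * (k * p).+1 %| n)%N -> 1 <= sylow_defect z x n.
Proof.
move=> pzx /andP[n0 nx] k0 kn.
have kx : (1 <= k < x.+1)%N.
  rewrite k0 ltnS (leq_trans _ nx) // (leq_trans _ (dvdn_leq n0 kn)) //.
  have p0 : (0 < p)%N by case/andP: pzx => /(leq_ltn_trans (leq0n _)).
  by rewrite (leq_trans _ (leq_pmull _ p0)) // (leq_trans (leq_pmulr _ p0)).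
apply: (@le_trans _ _ (\sum_(1 <= j < x.+1) (p * (j * p).+1 %| n)%N%:R)).
  by apply: le_trans (le_sum_nat_term _ kx); rewrite ?kn.
apply: le_trans
  (le_sum_nat_term (F := fun q => \sum_(1 <= j < x.+1) (q * (j * q).+1 %| n)%N%:R) _ pzx) _.
  by move=> q; apply: sumr_ge0.
by rewrite lerDr sumr_ge0.
Qed.

(** Take z = w^2 with w maximal such that w^(2E) <= x. Then (z, z^E] lies below x, so mu >= K, while
    ln x = O(w) is small against z. *)
Lemma sieve_density_zero t (z0 : nat) :
  (forall K : nat, exists2 E, (0 < E)%N & exists u0, forall u, (u0 <= u)%N ->
    K%:R <= \sum_(u.+1 <= p < (u ^ E).+1 | prime p && t p) p%:R^-1 :> R) ->
  forall e : R, 0 < e -> exists x0, forall x, (x0 <= x)%N ->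
    exists2 z, (z0 <= z)%N & \sum_(1 <= n < x.+1)
      ((~~ has (fun p => [&& prime p, t p & (p %| n)%N]) (index_iota z.+1 x.+1))%:R
       + sylow_defect z x n) <= e * x%:R.
Proof.
move=> H e e0.
pose K := (Num.bound (6 / e)).
have eK : 6 / e <= K%:R by rewrite ltW // archi_boundP // divr_ge0 // ltW.
have [E E0 [u0 hu]] := H K.
(* The last bound makes (2 + 2E)/w <= e/2 for the defect; K >= 6/e makes 3/mu <= e/2 for the Turan
   term. *)
pose w0 := maxn (maxn 1 (maxn z0 u0)) (Num.bound ((4 + 4 * E%:R) / e)).
exists (w0 ^ (2 * E))%N => x xw0.
have w01 : (0 < w0)%N by rewrite !leq_max.
have x1 : (0 < x)%N by apply: leq_trans xw0; rewrite expn_gt0 w01.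
have exw : exists w, (w ^ (2 * E) <= x)%N by exists w0.
have bw w : (w ^ (2 * E) <= x)%N -> (w <= x)%N.
  case: w => // w; apply: leq_trans; rewrite -[X in (X <= _)%N]expn1.
  by rewrite leq_pexp2l // muln_gt0.
case: (ex_maxnP exw bw) => w wx wmax.
have w0w : (w0 <= w)%N by apply: wmax.
have w1 : (0 < w)%N by apply: leq_trans w0w.
have xw : (x < w.+1 ^ (2 * E))%N.
  by rewrite ltnNge; apply/negP => /wmax; rewrite ltnn.
have ww2 : (w <= w ^ 2)%N by rewrite -[X in (X <= _)%N]expn1 leq_pexp2l.
have := w0w; rewrite !geq_max => /andP[/andP[_ /andP[z0w u0w]] ew].
exists (w ^ 2)%N; first exact: leq_trans ww2.
rewrite big_split /=.
set mu := \sum_((w ^ 2).+1 <= p < x.+1 | prime p && t p) p%:R^-1 : R.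
have muK : K%:R <= mu.
  apply: le_trans (hu (w ^ 2)%N (leq_trans u0w ww2)) _; rewrite -expnM.
  rewrite /mu [leRHS](@big_cat_nat _ _ _ (w ^ (2 * E)).+1) //=.
    by rewrite lerDl sumr_ge0 // => p _; rewrite invr_ge0.
  by rewrite ltnS leq_pexp2l // leq_pmulr.
have mu0 : 0 < mu by apply: lt_le_trans (le_trans eK muK); rewrite divr_gt0.
apply: le_trans (lerD (turan_sieve mu0) (sum_sylow_defect_le _ x1)) _.
  by rewrite expn_gt0 w1.
have x0R : 0 <= x%:R :> R by [].
have h1 : 3 / mu <= e / 2.
  rewrite ler_pdivrMr //; have := le_trans eK muK.
  rewrite ler_pdivrMr //; lra.
have w0R : 0 < w%:R :> R by rewrite ltr0n.
have lx : ln x%:R <= 2 * E%:R * w%:R :> R.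
  apply: le_trans (ln_nat_le _ x1 (ltnW xw)) _.
  rewrite natrX lnXn ?ltr0n // -[leLHS]mulr_natl natrM ler_wpM2l ?mulr_ge0 //.
  by apply: le_trans (ln_nat_sub1 _ _) _; rewrite // -natr1 addrK.
have h2 : (2 + ln x%:R) / (w ^ 2)%:R <= e / 2.
  rewrite natrX ler_pdivrMr ?exprn_gt0 //.
  apply: (@le_trans _ _ ((2 + 2 * E%:R) * w%:R)).
    rewrite mulrDl lerD // ler_peMr // ler1n //.
  rewrite expr2 mulrA; apply: ler_wpM2r => //.
  have := archi_boundP (_ : 0 <= (4 + 4 * E%:R) / e).
  rewrite divr_ge0 ?addr_ge0 ?mulr_ge0 ?(ltW e0) // => /(_ isT) h.
  have : (4 + 4 * E%:R) / e <= w%:R.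
    by apply: le_trans (ltW h) _; rewrite ler_nat.
  rewrite ler_pdivrMr //; lra.
rewrite (_ : 3 * x%:R / mu = x%:R * (3 / mu)); last by ring.
rewrite -[X in _ + X]mulrA -mulrDr [leRHS]mulrC ler_wpM2l //; lra.
Qed.

End Sieve.

Local Close Scope ring_scope.

(** * Finite groups with a normal Sylow subgroup of prime order *)

Section NormalSylow.
(* Undoes the shadowing of finset lemmas by classical_sets. *)
Import mathcomp.boot.fintype mathcomp.boot.finset.
Local Open Scope group_scope.

(** The number kp + 1 of Sylow p-subgroups divides the order and is prime to p, so p (kp + 1)
    divides it as well; hence k = 0. *)
Lemma normal_Sylow_of_card (gT : finGroupType) (G : {group gT}) (p : nat) :
  prime p -> (p %| #|G|)%N ->
  (forall k, (0 < k)%N -> ~~ (p * (k * p).+1 %| #|G|)%N) ->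
  exists2 P : {group gT}, p.-Sylow(G) P & P <| G.
Proof.
move=> pp pG h; have := card_Syl_mod G pp; have := card_Syl_dvd p G.
set s := #|_| => sG smod.
suff /eqP/normal_sylowP[P sylP nPG] : s = 1%N.
  by exists P => //; rewrite /normal (pHall_sub sylP).
have := divn_eq s p; rewrite smod addn1 => Es.
have [k0|k0] := posnP (s %/ p)%N; first by rewrite Es k0.
have /negP[] := h _ k0; rewrite -Es Gauss_dvd ?pG //.
by rewrite -coprime_modr smod coprimen1.
Qed.

(** Conjugation embeds this quotient in Aut(P), which is cyclic of order p - 1. *)
Lemma quotient_cent_cyclic (gT : finGroupType) (G P : {group gT}) (p : nat) :
  prime p -> #|P| = p -> P <| G ->
  cyclic (G / 'C_G(P)) /\ (#|G / 'C_G(P)| %| p.-1)%N.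
Proof.
move=> pp oP /andP[_ nPG].
have iso : G / 'C_G(P) \isog conj_aut P @* G.
  by rewrite -(ker_conj_aut P); apply: first_isog_loc.
have sub : conj_aut P @* G \subset Aut P by apply: Aut_conj_aut.
rewrite (isog_cyclic iso) (card_isog iso); split.
  by apply: cyclicS sub _; apply: Aut_prime_cyclic; rewrite oP.
have cP : cyclic P by apply: prime_cyclic; rewrite oP.
by rewrite -totient_prime // -oP -card_Aut_cyclic // cardSg.
Qed.

Lemma dihedral_quotient (gT : finGroupType) (G : {group gT}) (p n0 : nat) :
  prime p -> (n0 < p)%N -> (p %| #|G|)%N -> ~~ (p ^ 2 %| #|G|)%N ->
  (forall k, (0 < k)%N -> ~~ (p * (k * p).+1 %| #|G|)%N) ->
  (forall N : {group gT}, N <| G -> cyclic (G / N) -> (#|G / N| <= n0)%N) ->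
  (forall d, (d %| p.-1)%N -> (0 < d <= n0)%N -> (d <= 2)%N) ->
  exists2 N : {group gT}, N <| G & (G / N) \isog 'D_(2 * p).
Proof.
move=> pp np pG p2G hk hcyc hd.
have [P sylP nPG] := normal_Sylow_of_card pp pG hk.
have oP : #|P| = p.
  rewrite (card_Hall sylP) p_part; have : logn p #|G| = 1%N.
    apply/eqP; rewrite eqn_leq -pfactor_dvdn ?cardG_gt0 // expn1 pG andbT.
    by rewrite leqNgt -pfactor_dvdn ?cardG_gt0.
  by move->.
have [sPG nPG'] := andP nPG.
have [cycC dC] := quotient_cent_cyclic pp oP nPG.
have nCG : 'C_G(P) <| G.
  by rewrite /normal subsetIl normsI ?normG // norms_cent.
have d2 : (#|G / 'C_G(P)| <= 2)%N.
  by apply: hd => //; rewrite cardG_gt0 hcyc.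
have [K] := splitsP (SchurZassenhaus_split (pHall_Hall sylP) nPG).
case/complP => tiPK PK.
have sKG : K \subset G by rewrite -PK mulG_subr.
have abP : abelian P by apply: cyclic_abelian; apply: prime_cyclic; rewrite oP.
pose L := 'C_K(P)%G.
have sLK : L \subset K by apply: subsetIl.
have sLG : L \subset G by apply: subset_trans sKG.
(* P centralizes L, K normalizes it, and G = P K. *)
have nLG : L <| G.
  rewrite /normal sLG -PK mul_subG //.
    by apply: cents_norm; rewrite centsC subsetIr.
  by rewrite normsI ?normG // norms_cent // (subset_trans sKG).
(* Dedekind's modular law, as the abelian group P centralizes itself. *)
have CE : P * L = 'C_G(P).
  by rewrite -PK -group_modl.
have tiPL : P :&: L = 1 by apply/trivgP; rewrite -tiPK setIS.
have oGL : #|G / L| = (#|G / 'C_G(P)| * p)%N.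
  rewrite !card_quotient ?normal_norm //.
  apply/eqP; rewrite -(eqn_pmul2l (cardG_gt0 L)) Lagrange //.
  have oC : #|'C_G(P)%G| = (p * #|L|)%N by rewrite /= -CE TI_cardMg // oP.
  rewrite -(Lagrange (subsetIl G 'C(P))) oC.
  by rewrite -mulnA mulnCA (mulnC p).
have d_neq1 : #|G / 'C_G(P)| != 1%N.
  apply/eqP => d1; rewrite d1 mul1n in oGL.
  have := hcyc L nLG; rewrite oGL => /(_ (prime_cyclic _)).
  by rewrite leqNgt np oGL => /(_ pp).
have d_eq2 : #|G / 'C_G(P)| = 2.
  by apply/eqP; rewrite eqn_leq d2 ltn_neqAle eq_sym d_neq1 cardG_gt0.
rewrite d_eq2 in oGL dC.
have op : odd p by case: (even_prime pp) => // p2; rewrite p2 in dC.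
exists L => //.
have nKC : ~~ (K \subset 'C(P)).
  apply/negP => KC; case/eqP: d_neq1.
  apply/eqP; rewrite -trivg_card1; apply/eqP.
  apply/trivgP; rewrite quotient_sub1 ?normal_norm //.
  by rewrite subsetI subxx -PK mul_subG.
have /subsetPn[y Ky nCy] := nKC.
have p1 : (1 < #|P|)%N by rewrite oP prime_gt1.
have /trivgPn[x Px nx1] : P :!=: 1 by rewrite -cardG_gt1.
have ox : #[x] = p.
  by apply: nt_prime_order; rewrite // -oP; apply: expg_cardG.
have EP : P :=: <[x]>.
  by apply/esym/eqP; rewrite eqEcard cycle_subG Px oP -ox leqnn.
have Gx : x \in G := subsetP sPG x Px.
have Gy : y \in G := subsetP sKG y Ky.
have NC : G \subset 'N('C_G(P)) := normal_norm nCG.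
have NL : G \subset 'N(L) := normal_norm nLG.
have Cy2 : y ^+ 2 \in 'C_G(P).
  apply: coset_idr (subsetP NC _ (groupX 2 Gy)) _.
  by rewrite morphX ?(subsetP NC) //= -d_eq2 expg_cardG // mem_quotient.
have Py z : z \in P -> z ^ y \in P.
  by move=> Pz; rewrite memJ_norm // (subsetP nPG').
have Pxx : x * x ^ y \in P by rewrite groupM ?Py.
have fixed : (x * x ^ y) ^ y = x * x ^ y.
  have x2 : x ^ (y ^+ 2) = x.
    by apply/conjg_fixP/commgP; case/setIP: Cy2 => _ /centP c; apply/commute_sym/c.
  by rewrite conjMg -conjgM -[y * y]/(y ^+ 2) x2; apply: (centsP abP); rewrite ?Py.
(* The product of x and x^y is fixed by y, because y^2 centralizes x. Were it nontrivial, it would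
   generate P and y would centralize P. *)
have xy : x ^ y = x^-1.
  apply/eqP; rewrite eq_sym eq_invg_mul; apply/negPn/negP => nz.
  case/negP: nCy.
  have EP' : P :=: <[x * x ^ y]>.
    apply/esym/eqP; rewrite eqEcard cycle_subG Pxx oP.
    rewrite -[#|_|]/#[_] (nt_prime_order pp _ nz) ?leqnn // -oP.
    exact: expg_cardG.
  by rewrite EP' cent_cycle; apply/cent1P/commute_sym/commgP/conjg_fixP.
pose x' := coset L x; pose y' := coset L y.
have Lx : x \notin L.
  apply/negP => Lx; case/negP: nx1.
  by rewrite -in_set1 -[[set 1]]/[1 gT] -tiPL inE Px.
have Ly : y \notin L by apply: contra nCy => /setIP[].
have Ly2 : y ^+ 2 \in L by rewrite inE groupX //; case/setIP: Cy2.
have NLx := subsetP NL x Gx; have NLy := subsetP NL y Gy.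
have x'p : x' ^+ p = 1 by rewrite -morphX // -ox expg_order morph1.
have y'2 : y' ^+ 2 = 1 by rewrite -morphX //= coset_id.
have ox' : #[x'] = p.
  by apply: nt_prime_order => //; apply: contra Lx => /eqP/coset_idr; apply.
have oy' : #[y'] = 2.
  by apply: nt_prime_order => //; apply: contra Ly => /eqP/coset_idr; apply.
have Gx' : x' \in G / L by apply: mem_quotient.
have Gy' : y' \in G / L by apply: mem_quotient.
have gen : <[x']> <*> <[y']> = G / L.
  apply/eqP; rewrite eqEcard join_subG !cycle_subG Gx' Gy' oGL /=.
  apply: dvdn_leq; first exact: cardG_gt0.
  rewrite Gauss_dvd; last by rewrite coprime2n.
  by rewrite -{1}oy' -ox' !cardSg ?joing_subl ?joing_subr.
(* The generators x', y' satisfy the dihedral presentation, so G / L is an image of the dihedral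
   group; equal orders make it isomorphic. *)
rewrite isogEcard mul2n.
rewrite card_dihedral ?prime_gt1 // oGL mul2n leqnn andbT.
rewrite Grp_dihedral ?prime_gt1 //.
apply/existsP; exists (x', y'); rewrite /= gen !xpair_eqE.
by rewrite x'p y'2 !eqxx /= -morphJ // xy morphV.
Qed.

End NormalSylow.

(** * Quotients of arbitrary groups *)

Import Algebra.

Local Open Scope classical_set_scope.
Local Open Scope group_scope.

Lemma bijective_card_eq (T U : Type) (f : T -> U) :
  bijective f -> ([set: T] #= [set: U])%card.
Proof. by rewrite -setTT_bijective => /Pbij[F _]; apply: pcard_eq F. Qed.

Lemma card_eq_bijective (T U : Type) :
  ([set: T] #= [set: U])%card -> exists f : T -> U, bijective f.
Proof.
move=> /card_bijP[f [g fK gK]].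
pose i V (x : V) : [set: V] := SigSub (mem_set (I : [set: V] x)).
exists (val \o f \o @i T), (val \o g \o @i U) => x /=.
  by rewrite (_ : i _ _ = f (i _ x)) ?fK //; apply: val_inj.
by rewrite (_ : i _ _ = g (i _ x)) ?gK //; apply: val_inj.
Qed.

Section Transport.
Variables (H : groupType) (m : nat) (f : H -> 'I_m) (g : 'I_m -> H).
Hypotheses (fK : cancel f g) (gK : cancel g f).

(** The cancellation proofs are arguments of the alias, so that the group structure attached to it
    can depend on them. *)
Definition transported_group of cancel f g & cancel g f := 'I_m.
Local Notation gT := (transported_group fK gK).

HB.instance Definition _ := Finite.on gT.

Definition transported_mul (x y : gT) : gT := f (g x * g y).
Definition transported_one : gT := f 1.
Definition transported_inv (x : gT) : gT := f (g x)^-1.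

Lemma transported_mulA : associative transported_mul.
Proof. by move=> x y z; rewrite /transported_mul !fK mulgA. Qed.

Lemma transported_mul1 : left_id transported_one transported_mul.
Proof. by move=> x; rewrite /transported_mul fK mul1g gK. Qed.

Lemma transported_mulV : left_inverse transported_one transported_inv transported_mul.
Proof. by move=> x; rewrite /transported_mul fK mulVg. Qed.

HB.instance Definition _ := Finite_isGroup.Build gT
  transported_mulA transported_mul1 transported_mulV.

Lemma transported_morphism (x y : H) : (f (x * y) : gT) = (f x : gT) * f y.
Proof. by rewrite [RHS]/mul /= /transported_mul !fK. Qed.

End Transport.

Lemma has_order_finGroup (H : groupType) (m : nat) : has_order H m ->
  exists (gT : finGroupType) (f : H -> gT),
    [/\ {morph f : x y / x * y}, bijective f & #|gT| = m].
Proof.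
move=> Hm; have [] := @card_eq_bijective H 'I_m.
  exact: card_eq_trans Hm card_II.
move=> f [g fK gK]; exists (transported_group fK gK), f; split.
- exact: transported_morphism.
- by exists g.
- exact: card_ord.
Qed.
Section Kernel.
Variables (G H : groupType) (f : G -> H).
Hypotheses (fM : {morph f : x y / x * y}) (fS : forall y, exists x, f x = y).

Lemma morph_f1 : f 1 = 1.
Proof. by apply: (@mulgI _ (f 1)); rewrite -fM !mulg1. Qed.

Lemma morph_fV x : f x^-1 = (f x)^-1.
Proof. by apply: (@mulgI _ (f x)); rewrite -fM !mulgV morph_f1. Qed.

Lemma kernelF x y : f x = 1 -> f y = 1 -> f (x * y^-1) = 1.
Proof. by move=> fx fy; rewrite fM morph_fV fx fy invg1 mulg1. Qed.

Lemma kernelJ x y : f x = 1 -> f (x ^ y) = 1.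
Proof. by move=> fx; rewrite conjgE !fM morph_fV fx mul1g mulVg. Qed.

Definition morph_kernel : normalSubgroup G :=
  @NormalSubgroup G (fun x => f x = 1) morph_f1 kernelF kernelJ.

Definition kernel_map (a : Defs.quotient_group morph_kernel) : H := f (repr a).

Lemma kernel_map_pi x : kernel_map (quotient_pi morph_kernel x) = f x.
Proof.
have /quotient_piP /= := quotient_reprK (quotient_pi morph_kernel x).
rewrite fM morph_fV => /(canRL (mulgVK _)). by rewrite mul1g.
Qed.

Lemma kernel_mapM : {morph kernel_map : a b / a * b}.
Proof.
move=> a b; rewrite -(quotient_reprK a) -(quotient_reprK b).
by rewrite [X in kernel_map X]quotient_piM !kernel_map_pi fM.
Qed.

Lemma kernel_map1 : kernel_map 1 = 1.
Proof. exact: etrans (kernel_map_pi 1) morph_f1. Qed.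

HB.instance Definition _ := isMultiplicative.Build _ _ kernel_map kernel_mapM.
HB.instance Definition _ := Multiplicative_isUMagmaMorphism.Build _ _ kernel_map kernel_map1.

Lemma kernel_map_bij : bijective kernel_map.
Proof.
have inj a b : kernel_map a = kernel_map b -> a = b.
  rewrite -(quotient_reprK a) -(quotient_reprK b) !kernel_map_pi => E.
  apply/quotient_piP => /=; by rewrite fM morph_fV E mulgV.
have [g gK] := choice fS.
exists (fun y => quotient_pi morph_kernel (g y)) => [a|y].
  by apply: inj; rewrite kernel_map_pi gK.
by rewrite kernel_map_pi gK.
Qed.

(** The first isomorphism theorem, leading from surjective homomorphisms back to quotients by a
    [normalSubgroup]. *)
Lemma surjection_quotient : has_quotient_isomorphic_to G H.
Proof.
exists morph_kernel; exists (kernel_map : UMagmaMorphism.type _ _).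
exact: kernel_map_bij.
Qed.

End Kernel.

Lemma card_setT_finType (T : finType) : ([set: T] #= `I_#|T|)%card.
Proof.
apply: card_eq_trans (bijective_card_eq (f := @enum_rank T) _) _.
  by exists enum_val; [apply: enum_rankK | apply: enum_valK].
by rewrite card_eq_sym card_II.
Qed.

Lemma cyclic_surjection_card (G : groupType) (n : nat) (gT : finGroupType)
    (f : G -> gT) :
  (forall N : normalSubgroup G, cyclic_group (Defs.quotient_group N) ->
     ([set: Defs.quotient_group N] #<= `I_n)%card) ->
  {morph f : x y / x * y} -> (forall y, exists x, f x = y) ->
  cyclic [set: gT]%G -> (#|gT| <= n)%N.
Proof.
move=> hG fM fS /cyclicP[x Ex]; have [N [k kbij]] := surjection_quotient fM fS.
have [kinv kK kinvK] := kbij.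
have kX a i : k (a ^+ i) = k a ^+ i.
  by elim: i => [|i IH]; rewrite ?expg0 ?gmulf1 // !expgS gmulfM IH.
have cycN : cyclic_group (Defs.quotient_group N).
  exists (kinv x) => a.
  have : k a \in <[x]> by rewrite -Ex inE.
  case/cycleP => i Ei; exists i; left; apply: (can_inj kK).
  by rewrite kX kinvK Ei.
rewrite -card_le_II -(card_le_eql (card_setT_finType gT)).
by rewrite -(card_le_eql (bijective_card_eq kbij)) hG.
Qed.

Lemma finite_quotient_morphism (G : groupType) (m : nat) :
  finite_quotient_orders G m -> exists (gT : finGroupType) (f : G -> gT),
    [/\ {morph f : x y / x * y}, forall y, exists x, f x = y & #|gT| = m].
Proof.
case=> N /has_order_finGroup[gT [f [fM [g fK gK] oT]]].
exists gT, (f \o quotient_pi N); split=> //.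
  by move=> x y /=; rewrite -fM -quotient_piM.
by move=> y; exists (repr (g y)); rewrite /= quotient_reprK gK.
Qed.

(** Composing with [coset N] makes each quotient of the finite image a quotient of G. This carries
    the cyclic bound down and the dihedral quotient back up. *)
Lemma finite_order_dihedral_quotient (G : groupType) (n0 m p : nat) :
  (forall N : normalSubgroup G, cyclic_group (Defs.quotient_group N) ->
     ([set: Defs.quotient_group N] #<= `I_n0)%card) ->
  finite_quotient_orders G m ->
  prime p -> (n0 < p)%N -> (p %| m)%N -> ~~ (p ^ 2 %| m)%N ->
  (forall k, (0 < k)%N -> ~~ (p * (k * p).+1 %| m)%N) ->
  (forall d, (d %| p.-1)%N -> (0 < d <= n0)%N -> (d <= 2)%N) ->
  has_quotient_isomorphic_to G (dihedral_gtype (2 * p)).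
Proof.
move=> hG /finite_quotient_morphism[gT [f [fM fS oT]]] pp np.
rewrite -oT -cardsT => pm p2m hk hd.
have cosM (N : {group gT}) : N <| [set: gT]%G ->
    {morph coset N \o f : x y / x * y}.
  by move=> /normal_norm nN x y /=; rewrite fM morphM //;
    apply: (fintype.subsetP nN); rewrite inE.
have cosS (K : {group gT}) : K <| [set: gT]%G ->
    forall y, exists x, (coset K \o f) x = y.
  by move=> nK y; have [z _ ->] := cosetP y; have [x <-] := fS z; exists x.
have setTq (N : {group gT}) : N <| [set: gT]%G ->
    [set: gT]%G / N = [set: coset_of N]%G.
  move=> nN; apply/finset.setP => y; rewrite [RHS]inE.
  by have [z Nz ->] := cosetP y; rewrite mem_quotient // inE.
have [|N nN /isogP[h injh imh]] :=
  dihedral_quotient (G := [set: gT]%G) pp np pm p2m hk _ hd.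
  move=> N nN; rewrite setTq // => cyc; rewrite cardsT.
  exact: cyclic_surjection_card hG (cosM N nN) (cosS N nN) cyc.
have hT y : y \in [set: gT]%G / N by rewrite setTq // inE.
apply: (@surjection_quotient _ _ (h \o (coset N \o f))).
  move=> x y; rewrite [LHS]/= (cosM N nN x y : coset N (f (x * y)) = _).
  by rewrite morphM.
move=> y; have : y \in h @* ([set: gT]%G / N) by rewrite imh inE.
case/morphimP => z _ _ ->; have [x <-] := cosS N nN z; by exists x.
Qed.

Local Close Scope group_scope.

(** * Counting and upper density *)

Section Density.
Local Open Scope ring_scope.
Variable R : realType.

Lemma card_fset_set_le_sum (X : set nat) (x : nat) (c : nat -> R) :
  (forall n, 0 <= c n) ->
  (forall n, (1 <= n <= x)%N -> X n -> 1 <= c n) ->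
  (#|` fset_set (X `&` [set k | (1 <= k <= x)%N])|)%:R <= \sum_(1 <= n < x.+1) c n.
Proof.
move=> c0 c1; set A := _ `&` _.
have finA : finite_set A.
  apply: (@sub_finite_set _ _ `I_x.+1); last exact: finite_II.
  by move=> k [_ /= /andP[]].
have memA n : (n \in fset_set A) -> (1 <= n <= x)%N /\ X n.
  by rewrite in_fset_set // inE => -[].
have pA : perm_eq (fset_set A) [seq n <- index_iota 1 x.+1 | n \in fset_set A].
  apply: uniq_perm; rewrite ?filter_uniq ?iota_uniq ?fset_uniq // => n.
  rewrite mem_filter mem_index_iota; apply/idP/andP => [nA|[]//].
  by split=> //; have [] := memA n nA.
rewrite -sum1_size natr_sum (perm_big _ pA) big_filter /=.
apply: (@le_trans _ _ (\sum_(1 <= n < x.+1 | n \in fset_set A) c n)).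
  by apply: ler_sum => n /memA[nx Xn]; apply: c1.
by rewrite big_mkcond; apply: ler_sum => n _; case: ifP.
Qed.

Lemma upper_density_le (X : set nat) (e : R) : 0 <= e ->
  (exists x0, forall x, (x0 <= x)%N ->
     (#|` fset_set (X `&` [set k | (1 <= k <= x)%N])|)%:R <= e * x%:R) ->
  (upper_density R X <= e%:E)%E.
Proof.
move=> e0 [x0 hx]; rewrite /upper_density /limn_esup.
set u := (u in limf_esup u _); rewrite limf_esupE.
apply: (@le_trans _ _ (ereal_sup (u @` [set x | (x0 <= x)%N]))).
  apply: ereal_inf_lbound; exists [set x | (x0 <= x)%N] => //.
  exact: nbhs_infty_ge.
apply: ge_ereal_sup => _ [x /= x0x <-]; rewrite /u lee_fin.
(* At x = 0 the ratio is 0 because 0^-1 = 0. *)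
have [->|x1] := posnP x; first by rewrite invr0 mulr0.
by rewrite ler_pdivrMr ?ltr0n // hx.
Qed.

Lemma upper_density_gt0 (X : set nat) : (0 < upper_density R X)%E ->
  exists2 e : R, 0 < e & forall x0, exists2 x, (x0 <= x)%N &
    e * x%:R < (#|` fset_set (X `&` [set k | (1 <= k <= x)%N])|)%:R.
Proof.
move=> dX; have [e e0 eX] : exists2 e : R, 0 < e & (e%:E < upper_density R X)%E.
  move: dX; case: (upper_density R X) => [r| |] //; rewrite ?lte_fin => r0.
    by exists (r / 2); rewrite ?divr_gt0 // lte_fin ltr_pdivrMr // ltr_pMr // ltr1n.
  by exists 1; rewrite // ltry.
exists e => // x0; apply: contrapT => nx; move: eX; apply/negP; rewrite -leNgt.
apply: upper_density_le; first exact: ltW.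
exists x0 => x xx0; rewrite leNgt; apply/negP => h; apply: nx.
by exists x.
Qed.

End Density.

Theorem theorem3p2 (R : realType) (G : groupType) :
  BCQO G ->
  (0 < upper_density R (finite_quotient_orders G))%E ->
  infinite_set
    [set p : nat | prime p /\ has_quotient_isomorphic_to G (dihedral_gtype (2 * p))].
Proof.
move=> [n0 _ hG] /upper_density_gt0[e e0 dense] /finite_seqP[s Es].
(* If the set is finite, [P0] bounds its primes; the sieve will produce one above [P0]. *)
pose P0 := \max_(p <- s) p.
have dihedral_le p : prime p ->
    has_quotient_isomorphic_to G (dihedral_gtype (2 * p)) -> (p <= P0)%N.
  move=> pp hp; have ps : p \in s.
    have : [set` s] p by rewrite -Es.
    by [].
  by rewrite /P0 (big_rem p) //= leq_maxl.
pose t := quad_nonresidue R (quad_moduli n0).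
have [x0 sieve] := sieve_density_zero (t := t) (maxn 1 (maxn n0 P0))
  (fun K => sum_inv_nonresidue_ge R K (quad_moduli_uniq n0) (quad_moduli_all n0)) e0.
have [x /sieve[z]] := dense x0; rewrite !geq_max => /and3P[z1 n0z P0z] few.
apply/negP; rewrite -leNgt; apply: le_trans few.
(* Each order n <= x must have sieve weight at least 1. Otherwise n has a suitable prime p > z with
   no Sylow defect, and G has a dihedral quotient with p > [P0]. *)
apply: card_fset_set_le_sum => [n|n /andP[n1 nx] Xn].
  by rewrite addr_ge0 ?sylow_defect_ge0.
case: hasP => [[p]|_] /=; last by rewrite lerDl sylow_defect_ge0.
rewrite mem_index_iota => /andP[zp px] /and3P[pp tp pn]; rewrite add0r.
apply: contrapT => small.
suff : (p <= P0)%N by rewrite leqNgt (leq_ltn_trans P0z).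
apply: dihedral_le => //.
apply: (finite_order_dihedral_quotient hG Xn pp _ pn).
- exact: leq_ltn_trans zp.
- apply/negP => p2n; apply: small; apply: sylow_defect_sqr p2n => //.
  by rewrite zp.
- move=> k k0; apply/negP => kn; apply: small; apply: sylow_defect_dvd kn;
  by rewrite ?zp ?n1.
- by move=> d; apply: quad_nonresidue_small_divisor tp.
Qed.
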